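(* Let $1<p,q<\infty$ and let $T:\ell^p_2\to\ell^q_2$ be a (real) linear operator with $\|T\|=1$. (i) If $p=q=2$, then $T$ is an extreme contraction if and only if $T$ is an isometry. (ii) If $p=2\neq q$, then $T$ is an extreme contraction if and only if $T$ satisfies one of the following: (a) $T$ attains its norm on two linearly independent vectors; (b) if $q<2$: $T=x\otimes e_i$ for some unit vector $x\in\ell^2_2$ and some $i\in\{1,2\}$; if $q>2$: $T=x\otimes y+s\,x^o\otimes (y^o)^{q-1}$ for some unit vector $x\in\ell^2_2$, some $y=(y_1,y_2)$ with $|y_1|^q=|y_2|^q=\frac12$, and $s=\pm\frac{1}{\sqrt{q-1}}\,2^{(q-2)/q}$. (iii) If $p\neq 2=q$, then $T$ is an extreme contraction if and only if $T$ satisfies one of the following: (a) $T$ attains its norm on two linearly independent vectors; (b) if $p>2$: $T=e_i\otimes y$ for some $i\in\{1,2\}$ and some unit vector $y\in\ell^2_2$; if $p<2$: $T=x^{p-1}\otimes y+s\,x^o\otimes y^o$ for some unit vector $y\in\ell^2_2$, some $x=(x_1,x_2)$ with $|x_1|^p=|x_2|^p=\frac12$, and $s=\pm\sqrt{p-1}\,2^{(2-p)/p}$. (iv) If $p=q\neq 2$, then $T$ is an extreme contraction if and only if $T$ satisfies one of the following: (a) $T$ attains its norm on two linearly independent vectors; (b) if $p>2$: $T=e_i\otimes y$ for some $i\in\{1,2\}$ and some unit vector $y=(y_1,y_2)\in\ell^p_2$ with $y_1y_2\neq0$; if $p<2$: $T=x^{p-1}\otimes e_j$ for some $j\in\{1,2\}$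 and some unit vector $x=(x_1,x_2)\in\ell^p_2$ with $x_1x_2\neq 0$. (v) If $1<q<2<p<\infty$, then $T$ is an extreme contraction if and only if $T$ satisfies one of the following: (a) $T$ attains its norm on two linearly independent vectors; (b) $T=x^{p-1}\otimes y$ for some unit vectors $x=(x_1,x_2)\in\ell^p_2$ and $y=(y_1,y_2)\in\ell^q_2$ with $x_1x_2y_1y_2=0$.
   Context: All scalars are real. For $1<p<\infty$, $\ell^p_2$ denotes $\mathbb{R}^2$ with the norm $\|(x_1,x_2)\|=(|x_1|^p+|x_2|^p)^{1/p}$. Operators $T:\ell^p_2\to\ell^q_2$ carry the operator norm; an extreme contraction is an extreme point of the closed unit ball of the space $\mathcal{L}(\ell^p_2,\ell^q_2)$ of all linear operators. $T$ attains its norm on a vector $u\ne0$ if $\|Tu\|=\|T\|\,\|u\|$. Notation: for a vector $x=(x_1,x_2)$ and $1<p<\infty$, $x^{p-1}=(\operatorname{sgn}(x_1)|x_1|^{p-1},\operatorname{sgn}(x_2)|x_2|^{p-1})$ and $x^o=(-x_2,x_1)$; thus $(y^o)^{q-1}$ is the result of applying the $(q-1)$-power operation to $y^o$. The vectors $e_1,e_2$ are $(1,0),(0,1)$. For $a,b\in\mathbb{R}^2$, $a\otimes b$ denotes the operator $z\mapsto (a_1z_1+a_2z_2)\,b$. *)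

(* Defs.v *)
From HB Require Import structures.
From mathcomp Require Import all_boot all_order all_algebra.
From mathcomp Require Import all_classical all_reals all_analysis.

Set Implicit Arguments.
Unset Strict Implicit.
Unset Printing Implicit Defensive.

Import Order.TTheory GRing.Theory Num.Theory.

Local Open Scope classical_set_scope.
Local Open Scope ring_scope.

(* Vectors of R^2 are columns 'cV[R]_2, with coordinates x 0 0 and x 1 0.
   A linear operator on R^2 is given by its matrix T : 'M[R]_2, acting by
   z |-> T *m z; its domain carries the p-norm and its codomain the q-norm. *)

Definition lpnorm (R : realType) (p : R) (x : 'cV[R]_2) : R :=
  (`|x 0 0| `^ p + `|x 1 0| `^ p) `^ p^-1.

Definition opnorm (R : realType) (p q : R) (T : 'M[R]_2) : R :=
  sup [set lpnorm q (T *m x) | x in [set x : 'cV[R]_2 | lpnorm p x <= 1]].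

Definition extreme_point (R : realType) (V : lmodType R) (K : set V) (x : V)
    : Prop :=
  K x /\ forall (y z : V) (t : R), K y -> K z -> 0 < t < 1 ->
    x = t *: y + (1 - t) *: z -> y = x /\ z = x.

Definition extreme_contraction (R : realType) (p q : R) (T : 'M[R]_2) : Prop :=
  extreme_point [set S : 'M[R]_2 | opnorm p q S <= 1] T.

Definition attains_norm (R : realType) (p q : R) (T : 'M[R]_2) (u : 'cV[R]_2)
    : Prop :=
  u != 0 /\ lpnorm q (T *m u) = opnorm p q T * lpnorm p u.

Definition attains_norm_on_two_independent (R : realType) (p q : R)
    (T : 'M[R]_2) : Prop :=
  exists u v : 'cV[R]_2,
    [/\ free [:: u; v], attains_norm p q T u & attains_norm p q T v].

Definition isometry_op (R : realType) (p q : R) (T : 'M[R]_2) : Prop :=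
  forall x : 'cV[R]_2, lpnorm q (T *m x) = lpnorm p x.

Definition spow (R : realType) (r : R) (x : 'cV[R]_2) : 'cV[R]_2 :=
  \col_i (Num.sg (x i 0) * `|x i 0| `^ r).

Definition perp (R : realType) (x : 'cV[R]_2) : 'cV[R]_2 :=
  \col_i (if i == 0 then - x 1 0 else x 0 0).

Definition evec (R : realType) (i : 'I_2) : 'cV[R]_2 := delta_mx i 0.
Arguments evec {R} i.

Definition rank_one (R : realType) (a b : 'cV[R]_2) : 'M[R]_2 := b *m a^T.

Lemma rank_oneE (R : realType) (a b z : 'cV[R]_2) :
  rank_one a b *m z = (a 0 0 * z 0 0 + a 1 0 * z 1 0) *: b.
Proof.
apply/matrixP => i j; rewrite /rank_one -mulmxA !mxE big_ord1 !mxE.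
rewrite !ord1 big_ord_recl big_ord1 !mxE mulrC.
by congr ((_ + a _ 0 * z _ 0) * _); apply/val_inj.
Qed.

(* Main.v *)
(* Let T have norm 1 and attain it at the unit vector x, with T x = y.  Smoothness
   of the norms forces T = T_s := x^{p-1} (x) y + s x^o (x) (y^o)^{q-1} for some
   real s, and strict convexity forces contractions averaging to T to be T_s' for
   the same x and y.  So T is extreme if and only if s is an endpoint of the set of
   s' with T_s' a contraction.
   With v = (x^{p-1})^o and w = (y^{q-1})^o one has T_s (x + t v) = y + s t w, and
   |x + t v|_p = 1 + c |t|^m + o(|t|^m), where m = 2 if x_1 x_2 <> 0 and m = p
   otherwise; likewise |y + t w|_q = 1 + c' |t|^n + o(|t|^n).  If n < m only s = 0 is
   possible.  If T attains its norm only on the line of x, then by compactness s can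
   be perturbed when n > m, or when n = m and c' |s|^m < c; hence extremality leaves
   n < m, s = 0, or the critical case n = m, c' |s|^m = c.
   If x_1 x_2 y_1 y_2 <> 0, the critical case compares |1 + l t Y|_q <= |1 + t X|_p for
   centred two-valued random variables with matching quadratic terms: the cubic
   terms must agree and the quartic ones must be ordered.  This is impossible for
   q <= 2 <= p, p <> q; for p = q <> 2 it makes T an isometry; and when just one of
   p, q is 2 it forces |x_1| = |x_2| or |y_1| = |y_2|. *)
Require Import Defs.
From mathcomp Require Import all_boot all_order all_algebra.
From mathcomp Require Import all_classical all_reals all_analysis.
From mathcomp Require Import ring lra.

Set Implicit Arguments.
Unset Strict Implicit.
Unset Printing Implicit Defensive.

Import Order.TTheory GRing.Theory Num.Theory.
Import numFieldNormedType.Exports.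

Local Open Scope ring_scope.

(** * Real powers: Bernoulli's inequality and the tangent inequality *)

Section PowerFunctions.
Variable R : realType.
Local Open Scope classical_set_scope.
Local Open Scope ring_scope.
Implicit Types (a b c p q r t u : R).

(** By the mean value theorem for [z^p - p z] between [u] and [1]: its derivative [p (z^(p-1) - 1)]
    has the sign of [z - 1]. *)
Lemma bernoulli_lt p u : 1 < p -> 0 < u -> u != 1 -> 1 + p * (u - 1) < u `^ p.
Proof.
move=> p1 u0 u1.
have der (x : R) : 0 < x ->
    is_derive x 1 (fun z : R => z `^ p - p * z) (p * x `^ (p - 1) - p).
  move=> x0.
  have -> : (fun z : R => z `^ p - p * z) = (@powR R ^~ p) - (p *: @idfun R) by [].
  apply: is_deriveB; last first.
    have := @is_deriveZ R _ _ (@idfun R) p x 1 1 _.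
    by rewrite /GRing.scale /= mulr1; apply.
  exact: is_derive1_powR.
have cont (l r : R) : 0 < l ->
    {within `[l, r], continuous (fun z : R => z `^ p - p * z)}.
  move=> l0; apply: derivable_within_continuous => z; rewrite in_itv /= => /andP[lz _].
  by have [] := der _ (lt_le_trans l0 lz).
have derI (l r : R) : 0 < l -> forall x, x \in `]l, r[ ->
    is_derive x 1 (fun z : R => z `^ p - p * z) (p * x `^ (p - 1) - p).
  by move=> l0 x; rewrite in_itv /= => /andP[lx _]; apply/der/(lt_trans l0).
have [ul|ur|/eqP] := ltgtP u 1; last by rewrite (negbTE u1).
- have [z zu] := MVT ul (derI _ _ u0) (cont _ _ u0).
  move: zu; rewrite in_itv /= => /andP[uz z1].
  have z0 : 0 < z by apply: lt_trans uz.
  rewrite powR1 mulr1 => e.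
  have zp : z `^ (p - 1) < 1.
    rewrite [ltRHS](_ : 1 = 1 `^ (p - 1)); last by rewrite powR1.
    by apply: gt0_ltr_powR; rewrite ?nnegrE ?subr_gt0 // ltW.
  have : (p * z `^ (p - 1) - p) * (1 - u) < 0.
    by rewrite pmulr_llt0 ?subr_gt0 // subr_lt0; nra.
  by rewrite -e; lra.
- have [z zu] := MVT ur (derI _ _ ltr01) (cont _ _ ltr01).
  move: zu; rewrite in_itv /= => /andP[uz z1].
  have z0 : 0 < z by apply: lt_trans uz.
  rewrite powR1 mulr1 => e.
  have zp : 1 < z `^ (p - 1).
    rewrite [ltLHS](_ : 1 = 1 `^ (p - 1)); last by rewrite powR1.
    by apply: gt0_ltr_powR; rewrite ?nnegrE ?subr_gt0 // ltW.
  have : 0 < (p * z `^ (p - 1) - p) * (u - 1).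
    by rewrite pmulr_lgt0 ?subr_gt0 //; nra.
  by rewrite -e; lra.
Qed.

(** The coordinatewise form of [spow]. For [p > 1], [p * sgpow (p - 1) a] is the derivative of
    [|a|^p], hence the slope in the tangent inequality. *)
Definition sgpow r a := Num.sg a * `|a| `^ r.

Lemma sgpowN r a : sgpow r (- a) = - sgpow r a.
Proof. by rewrite /sgpow sgrN normrN mulNr. Qed.

Lemma sgpow0 r : sgpow r 0 = 0.
Proof. by rewrite /sgpow sgr0 mul0r. Qed.

Lemma sgpow_gt0 r a : 0 < a -> sgpow r a = a `^ r.
Proof. by move=> a0; rewrite /sgpow gtr0_sg // gtr0_norm // mul1r. Qed.

Lemma sgpow1 a : sgpow 1 a = a.
Proof. by rewrite /sgpow powRr1 // -numEsg. Qed.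

Lemma normr_sgpow r a : r != 0 -> `|sgpow r a| = `|a| `^ r.
Proof.
move=> r0; rewrite /sgpow normrM norm_powR // normr_id normr_sg.
by have [->|] := eqVneq a 0; rewrite ?normr0 ?powR0 ?mulr0 // mul1r.
Qed.

Lemma mulr_sgpow p a : 0 < p -> sgpow (p - 1) a * a = `|a| `^ p.
Proof.
move=> p0; rewrite /sgpow mulrAC -normrEsg.
exact: mulr_powRB1.
Qed.

Lemma sgpowK r a : r != 0 -> sgpow r (sgpow r^-1 a) = a.
Proof.
move=> r0; rewrite {1}/sgpow normr_sgpow ?invr_eq0 // -powRrM mulVf // powRr1 //.
rewrite /sgpow sgrM; have [->|a0] := eqVneq a 0.
  by rewrite sgr0 normr0 mulr0.
rewrite (@gtr0_sg _ (_ `^ _)) ?powR_gt0 ?normr_gt0 // mulr1 sgr_id.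
by rewrite -numEsg.
Qed.

(* Its strictness yields the equality case of Hoelder's inequality and the
   uniqueness of support functionals, hence strict convexity and smoothness. *)
Lemma powR_tangent_lt p a c : 1 < p -> a != c ->
  `|c| `^ p + p * (sgpow (p - 1) c * (a - c)) < `|a| `^ p.
Proof.
move=> p1; have p0 : 0 < p by lra.
wlog c0 : a c / 0 <= c.
  move=> IH ac; have [c0|c0] := leP 0 c; first exact: IH.
  have := IH (- a) (- c); rewrite oppr_ge0 eqr_opp => /(_ (ltW c0) ac).
  by rewrite !normrN sgpowN; congr (_ + _ * _ < _); ring.
have [->|cn0] := eqVneq c 0 => ac.
  by rewrite normr0 sgpow0 mul0r mulr0 addr0 powR0 ?gt_eqF // powR_gt0 // normr_gt0.
have {cn0}c0 : 0 < c by rewrite lt_neqAle eq_sym cn0.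
(* By homogeneity [c = 1] remains, with [u = a / c]. A negative [u] is replaced by [- u], which
   increases the left side. *)
have key u : u != 1 -> 1 + p * (u - 1) < `|u| `^ p.
  move=> u1; have [u0|u0|->] := ltgtP u 0; last first.
  - by rewrite normr0 powR0 ?gt_eqF //; lra.
  - by rewrite gtr0_norm //; apply: bernoulli_lt.
  rewrite ltr0_norm //; have [e|n1] := eqVneq (- u) 1.
    by rewrite e powR1; nra.
  by apply: (lt_trans _ (bernoulli_lt p1 _ n1)); [nra|lra].
have cN0 : c != 0 by rewrite gt_eqF.
have /key : a / c != 1.
  by apply: contra ac => /eqP e; rewrite -(divfK cN0 a) e mul1r.
rewrite normrM powRM // normfV (gtr0_norm c0).
have cp : 0 < c `^ p by apply: powR_gt0.
have -> : c^-1 `^ p = (c `^ p)^-1.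
  by rewrite -powRN -(powR_inv1 (ltW c0)) -powRrM mulN1r.
rewrite ltr_pdivlMr // => h; apply: le_lt_trans h.
rewrite sgpow_gt0 // -(@mulr_powRB1 _ c p) //; last exact: ltW.
rewrite le_eqVlt; apply/orP; left; apply/eqP; field.
by rewrite gt_eqF.
Qed.

Lemma powR_tangent p a c : 1 < p ->
  `|c| `^ p + p * (sgpow (p - 1) c * (a - c)) <= `|a| `^ p.
Proof.
move=> p1; have [->|ac] := eqVneq a c; last exact/ltW/powR_tangent_lt.
by rewrite subrr !mulr0 addr0.
Qed.

End PowerFunctions.

(** * Norms on the plane: Hoelder, strict convexity, smoothness, triangle inequality *)

Section PlaneNorms.
Variable R : realType.
Implicit Types (k p q r : R) (x y z a c : 'cV[R]_2).

Lemma cV2P x y : x 0 0 = y 0 0 -> x 1 0 = y 1 0 -> x = y.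
Proof.
move=> e0 e1; apply/matrixP => i j; rewrite (ord1 j).
by have [->|->] : i = 0 \/ i = 1; [|exact: e0|exact: e1];
  case: i => [[|[|//]]] ?; [left|right]; apply/val_inj.
Qed.

Lemma perpE x : (perp x 0 0 = - x 1 0) * (perp x 1 0 = x 0 0).
Proof. by rewrite !mxE. Qed.

Lemma spowE r x i : spow r x i 0 = sgpow r (x i 0).
Proof. by rewrite mxE. Qed.

Lemma spow_perp r x : spow r (perp x) = perp (spow r x).
Proof. by apply: cV2P; rewrite !(perpE, spowE) ?sgpowN. Qed.

Definition dot x y : R := x 0 0 * y 0 0 + x 1 0 * y 1 0.

Definition psum p x : R := `|x 0 0| `^ p + `|x 1 0| `^ p.

Lemma psum_ge0 p x : 0 <= psum p x.
Proof. by rewrite addr_ge0 ?powR_ge0. Qed.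

Lemma lpnorm_ge0 p x : 0 <= lpnorm p x.
Proof. exact: powR_ge0. Qed.

Lemma lpnorm_powR p x : 0 < p -> lpnorm p x `^ p = psum p x.
Proof. by move=> p0; rewrite -powRrM mulVf ?gt_eqF // powRr1 ?psum_ge0. Qed.

Lemma lpnorm_eq1 p x : 0 < p -> (lpnorm p x = 1) <-> (psum p x = 1).
Proof.
move=> p0; split=> h; first by rewrite -lpnorm_powR // h powR1.
by rewrite /lpnorm -/(psum p x) h powR1.
Qed.

Lemma lpnormZ p k x : 0 < p -> lpnorm p (k *: x) = `|k| * lpnorm p x.
Proof.
move=> p0; rewrite /lpnorm !mxE !normrM !powRM // -mulrDr.
rewrite powRM ?powR_ge0 ?psum_ge0 // -powRrM mulfV ?gt_eqF // powRr1 //.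
Qed.

Lemma lpnorm_gt0 p x : 0 < p -> (0 < lpnorm p x) = (x != 0).
Proof.
move=> p0; apply/idP/idP => [|x0].
  apply: contraTneq => ->; rewrite -leNgt -(scale0r 0) lpnormZ //.
  by rewrite normr0 mul0r.
rewrite powR_gt0 // lt_neqAle psum_ge0 andbT eq_sym paddr_eq0 ?powR_ge0 //.
rewrite !powR_eq0 !normr_eq0 (gt_eqF p0) !andbT; apply: contra x0 => /andP[/eqP e0 /eqP e1].
by apply/eqP/cV2P; rewrite mxE.
Qed.

Lemma lpnorm0 p : 0 < p -> lpnorm p (0 : 'cV[R]_2) = 0.
Proof. by move=> p0; rewrite -(scale0r 0) lpnormZ // normr0 mul0r. Qed.

Lemma lpnorm_normalize p x : 0 < p -> x != 0 ->
  lpnorm p ((lpnorm p x)^-1 *: x) = 1.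
Proof.
move=> p0; rewrite -(lpnorm_gt0 x p0) => n0.
by rewrite lpnormZ // gtr0_norm ?invr_gt0 // mulVf // gt_eqF.
Qed.

Lemma dotC x y : dot x y = dot y x.
Proof. by rewrite /dot; ring. Qed.

Lemma dotZr k x y : dot x (k *: y) = k * dot x y.
Proof. by rewrite /dot !mxE; ring. Qed.

Lemma dotDr x y z : dot x (y + z) = dot x y + dot x z.
Proof. by rewrite /dot !mxE; ring. Qed.

Lemma dot_perp x : dot x (perp x) = 0.
Proof. by rewrite /dot !perpE; ring. Qed.

Lemma dot_perp2 x y : dot (perp x) (perp y) = dot x y.
Proof. by rewrite /dot !perpE; ring. Qed.

Lemma dot_spow p x : 0 < p -> dot (spow (p - 1) x) x = psum p x.
Proof. by move=> p0; rewrite /dot !spowE !mulr_sgpow. Qed.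

Lemma psum_tangent p a c : 1 < p ->
  psum p c + p * (dot (spow (p - 1) c) a - dot (spow (p - 1) c) c) <= psum p a.
Proof.
move=> p1; have := powR_tangent (a 0 0) (c 0 0) p1.
have := powR_tangent (a 1 0) (c 1 0) p1.
by rewrite /psum /dot !spowE; lra.
Qed.

Lemma psum_tangent_lt p a c : 1 < p -> a != c ->
  psum p c + p * (dot (spow (p - 1) c) a - dot (spow (p - 1) c) c) < psum p a.
Proof.
move=> p1 ac; have := powR_tangent (a 0 0) (c 0 0) p1.
have := powR_tangent (a 1 0) (c 1 0) p1.
have [e0|n0] := eqVneq (a 0 0) (c 0 0); last first.
  by have := powR_tangent_lt p1 n0; rewrite /psum /dot !spowE; lra.
have n1 : a 1 0 != c 1 0 by apply: contra ac => /eqP e1; apply/eqP/cV2P.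
by have := powR_tangent_lt p1 n1; rewrite /psum /dot !spowE; lra.
Qed.

(** The tangent inequality at [c], applied to [a] divided by its norm: both power sums are 1, so the
    linear term cannot be positive. *)
Lemma hoelder_dot p a c : 1 < p -> lpnorm p c = 1 ->
  dot (spow (p - 1) c) a <= lpnorm p a.
Proof.
move=> p1 c1; have p0 : 0 < p := lt_trans ltr01 p1.
have [->|a0] := eqVneq a 0; first by rewrite lpnorm0 // -(scale0r 0) dotZr mul0r.
have := psum_tangent ((lpnorm p a)^-1 *: a) c p1.
move/(lpnorm_eq1 _ p0) : (c1) => c1'.
have /(lpnorm_eq1 _ p0) -> := lpnorm_normalize p0 a0.
rewrite dot_spow // c1' dotZr.
move: a0; rewrite -(lpnorm_gt0 _ p0) => a0 h.
have : (lpnorm p a)^-1 * dot (spow (p - 1) c) a <= 1.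
  by move: h; rewrite gerDl pmulr_rle0 // subr_le0.
by rewrite mulrC ler_pdivrMr // mul1r.
Qed.

(** Strict convexity: if [a] differed from [c], the strict tangent inequality would read [1 < 1]. *)
Lemma hoelder_dot_eq p a c : 1 < p -> lpnorm p c = 1 ->
  dot (spow (p - 1) c) a = 1 -> lpnorm p a <= 1 -> a = c.
Proof.
move=> p1 c1 e a1; have p0 : 0 < p := lt_trans ltr01 p1.
have {a1}a1 : lpnorm p a = 1.
  by apply/eqP; rewrite eq_le a1 -e hoelder_dot.
apply/eqP/negPn/negP => /(psum_tangent_lt p1).
rewrite e dot_spow //.
move/(lpnorm_eq1 _ p0) : c1 => ->; move/(lpnorm_eq1 _ p0) : a1 => ->.
by rewrite subrr mulr0 addr0 ltxx.
Qed.

(** Smoothness. Write [phi] as [spow (p - 1) c]. Testing [phi] on [c] gives [N^p <= N] for the norm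
    [N] of [c], so [S = psum p c <= 1]. If [x] were not [c], the strict tangent inequality at [c]
    would give [S + p (1 - S) < 1], that is [(p - 1) (1 - S) < 0]. *)
Lemma support_functional_unique p (phi x : 'cV[R]_2) : 1 < p ->
  (forall z, dot phi z <= lpnorm p z) -> lpnorm p x = 1 -> dot phi x = 1 ->
  phi = spow (p - 1) x.
Proof.
move=> p1 hphi x1 e; have p0 : 0 < p := lt_trans ltr01 p1.
have p10 : p - 1 != 0 by rewrite gt_eqF // subr_gt0.
pose c := spow (p - 1)^-1 phi.
have phiE : phi = spow (p - 1) c by apply: cV2P; rewrite !spowE sgpowK.
have pc : psum p c <= 1.
  have := hphi c; rewrite phiE dot_spow // -lpnorm_powR // => h.
  have [n1|n1] := leP (lpnorm p c) 1.
    by have := ge0_ler_powR (ltW p0) _ _ n1; rewrite !nnegrE lpnorm_ge0 ler01 powR1 => /(_ isT isT); apply: le_trans; rewrite lpnorm_powR.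
  have n0 : 0 < lpnorm p c by exact: lt_trans n1.
  have : 1 `^ (p - 1) < lpnorm p c `^ (p - 1).
    by apply: gt0_ltr_powR; rewrite ?nnegrE ?ler01 ?subr_gt0 ?ltW.
  move: h; rewrite -(@mulr_powRB1 _ (lpnorm p c) p) ?(ltW n0) //.
  by rewrite powR1 -[leRHS]mulr1 ler_pM2l // leNgt => /negP h /h.
have [->//|] := eqVneq x c.
move=> /(psum_tangent_lt p1); rewrite -phiE e {1}phiE dot_spow //.
move/(lpnorm_eq1 _ p0) : x1 => ->.
have := mulr_ge0 (ltW p0) (_ : 0 <= 1 - psum p c).
move: (psum p c) pc => S S1; rewrite subr_ge0 => /(_ S1) h1 h2.
have : 0 <= (p - 1) * (1 - S) by rewrite mulr_ge0 // subr_ge0 // ltW.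
by rewrite mulrBl mul1r => h3; exfalso; lra.
Qed.

(** The norm of [x + y] is its pairing with the support functional of its own direction [c], and
    Hoelder bounds each summand of that pairing. *)
Lemma ler_lpnormD p x y : 1 < p -> lpnorm p (x + y) <= lpnorm p x + lpnorm p y.
Proof.
move=> p1; have p0 : 0 < p := lt_trans ltr01 p1.
have [->|n0] := eqVneq (x + y) 0; first by rewrite lpnorm0 // addr_ge0 ?lpnorm_ge0.
pose c := (lpnorm p (x + y))^-1 *: (x + y).
have c1 : lpnorm p c = 1 by apply: lpnorm_normalize.
have h : dot (spow (p - 1) c) (x + y) = lpnorm p (x + y).
  have -> : x + y = lpnorm p (x + y) *: c.
    by rewrite scalerA mulfV ?scale1r // gt_eqF // lpnorm_gt0.
  rewrite dotZr dot_spow //; have /(lpnorm_eq1 _ p0) -> := c1.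
  by rewrite lpnormZ // c1 !mulr1 ger0_norm ?lpnorm_ge0.
by rewrite -h dotDr lerD ?hoelder_dot.
Qed.

End PlaneNorms.

(** * Taylor expansion of real powers at 1 *)

Section Expansions.
Variable R : realType.
Local Open Scope classical_set_scope.
Local Open Scope ring_scope.
Implicit Types (a c d p r t u x : R) (f g : R -> R).

(** One integration step: a bound of order [n] on the derivative becomes one of order [n + 1], with
    the same constant and radius. *)
Lemma mvt_bound f (df : R -> R) d c n :
  (forall x, `|x| <= d -> is_derive x 1 f (df x)) -> f 0 = 0 ->
  (forall x, `|x| <= d -> `|df x| <= c * `|x| ^+ n) ->
  forall x, `|x| <= d -> `|f x| <= c * `|x| ^+ n.+1.
Proof.
move=> der f0 bnd x xd.
have c0 : 0 <= c * `|x| ^+ n by apply: le_trans (normr_ge0 _) (bnd x xd).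
have cn t : `|t| <= `|x| -> `|df t| <= c * `|x| ^+ n.
  move=> tx; apply: le_trans (bnd _ (le_trans tx xd)) _.
  have [x0|x0] := eqVneq x 0.
    by move: tx; rewrite x0 normr0 normr_le0 => /eqP ->; rewrite normr0.
  have : 0 <= c by rewrite -(@pmulr_lge0 _ (`|x| ^+ n)) // exprn_gt0 // normr_gt0.
  by move=> c1; apply: ler_wpM2l => //; apply: lerXn2r; rewrite ?nnegrE.
suff [t tx ->] : exists2 t, `|t| <= `|x| & f x = df t * x.
  by rewrite normrM exprSr mulrA ler_wpM2r // cn.
have dab (l s : R) : (forall z, z \in `[l, s] -> `|z| <= `|x|) ->
   (forall z, z \in `]l, s[ -> is_derive z 1 f (df z)) /\
   {within `[l, s], continuous f}.
  move=> ls; split=> [z zls|].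
    by apply: der; apply: le_trans xd; apply: ls; apply: subset_itv_oo_cc.
  apply: derivable_within_continuous => z /ls zx.
  by have [] := der _ (le_trans zx xd).
have [x0|x0] := leP 0 x.
  have [z|dr ct] := dab 0 x.
    by rewrite in_itv /= => /andP[z0 zx]; rewrite !ger0_norm.
  have [t] := MVT_segment x0 dr ct; rewrite in_itv /= => /andP[t0 tx].
  by rewrite f0 !subr0 => e; exists t => //; rewrite !ger0_norm.
have [z|dr ct] := dab x 0.
  by rewrite in_itv /= => /andP[z0 zx]; rewrite (ltr0_norm x0) ler0_norm // lerN2.
have [t] := MVT_segment (ltW x0) dr ct; rewrite in_itv /= => /andP[t0 tx].
rewrite f0 !sub0r mulrN => /eqP; rewrite eqr_opp => /eqP e.
by exists t => //; rewrite (ltr0_norm x0) ler0_norm // lerN2.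
Qed.

(** Generalised binomial coefficients. Recursing on [r - 1] matches the differentiation of
    [(1 + u)^r]. *)
Fixpoint gbinom r (k : nat) : R :=
  if k is k'.+1 then r * gbinom (r - 1) k' / k'.+1%:R else 1.

Definition binom_poly r n : {poly R} := \poly_(k < n) gbinom r k.

Lemma deriv_binom_poly r n :
  (binom_poly r n.+1)^`() = r *: binom_poly (r - 1) n.
Proof.
apply/polyP => k; rewrite coef_deriv coefZ !coef_poly ltnS.
case: ltnP => _; last by rewrite mul0rn mulr0.
by rewrite /= -(mulr_natr (_ / _)) divfK // pnatr_eq0.
Qed.

(** By induction on [n]: the derivative of the remainder for [r] at order [n + 1] is [r] times the
    remainder for [r - 1] at order [n]. *)
Lemma powR_taylor n r : exists c, forall u, `|u| <= 2^-1 ->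
  `|(1 + u) `^ r - (binom_poly r n).[u]| <= c * `|u| ^+ n.
Proof.
elim: n r => [|n IHn] r.
  (* Since [1/2 <= 1 + u <= 2], one summand serves for [r >= 0] and the other for [r < 0]. *)
  exists (2 `^ r + 2 `^ (- r)) => u; rewrite ler_norml => /andP[u1 u2].
  have -> : binom_poly r 0 = 0 by apply/polyP => k; rewrite coef_poly coef0.
  rewrite horner0 subr0 expr0 mulr1 ger0_norm ?powR_ge0 //.
  have u0 : 0 < 1 + u by lra.
  have [r0|r0] := leP 0 r.
    rewrite -[leLHS]addr0 lerD ?powR_ge0 //; apply: ge0_ler_powR; rewrite ?nnegrE; lra.
  have -> : (1 + u) `^ r = (1 + u)^-1 `^ (- r).
    by rewrite -(powR_inv1 (ltW u0)) -powRrM mulN1r opprK.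
  rewrite -[leLHS]add0r lerD ?powR_ge0 //.
  apply: ge0_ler_powR; rewrite ?nnegrE ?oppr_ge0 ?invr_ge0 ?(ltW u0) ?(ltW r0) //.
  by rewrite -[leRHS]invrK lef_pV2 ?posrE //; lra.
have [c hc] := IHn (r - 1).
exists (`|r| * c); apply: (@mvt_bound _
  (fun u => r * ((1 + u) `^ (r - 1) - (binom_poly (r - 1) n).[u]))).
- move=> x; rewrite ler_norml => /andP[x1 x2].
  have x0 : 0 < 1 + x by lra.
  rewrite mulrBr -[in X in _ - X]hornerZ -deriv_binom_poly.
  apply: is_deriveB.
  have dp := @is_derive1_powR R r (1 + x) x0.
  have da : is_derive x 1 (fun u : R => 1 + u) 1.
    have := @is_deriveD R _ _ (cst (1 : R)) (@idfun R) x 1 0 1 _ _.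
    by rewrite add0r; apply.
  by have := @is_derive1_comp _ (@powR R ^~ r) _ x _ _ dp da; rewrite mulr1.
- rewrite addr0 powR1 horner_coef0 coef_poly /= subrr //.
- move=> x xd; rewrite normrM -mulrA ler_wpM2l // hc //.
Qed.

End Expansions.

(** * Calculus of remainders of integer order at 0 *)

Section BigO.
Variable R : realType.
Implicit Types (a c d p r t u x : R) (f g h : R -> R).

Lemma binom_poly3E r u :
  (binom_poly r 3).[u] = 1 + r * u + r * (r - 1) / 2 * u ^+ 2.
Proof.
by rewrite horner_poly !big_ord_recr big_ord0 /=; field.
Qed.

Lemma binom_poly5E r u :
  (binom_poly r 5).[u] = 1 + r * u + r * (r - 1) / 2 * u ^+ 2
    + r * (r - 1) * (r - 2) / 6 * u ^+ 3
    + r * (r - 1) * (r - 2) * (r - 3) / 24 * u ^+ 4.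
Proof.
by rewrite horner_poly !big_ord_recr big_ord0 /=; field.
Qed.

(** The clause [d <= 1] makes higher powers of [|t|] smaller, so that the order may be lowered
    without changing the constants. *)
Definition bigO0 n f := exists c d, [/\ 0 <= c, 0 < d, d <= 1 &
  forall t, `|t| <= d -> `|f t| <= c * `|t| ^+ n].

Lemma bigO0_ext n f g : f =1 g -> bigO0 n f -> bigO0 n g.
Proof.
move=> fg [c [d [c0 d0 d1 h]]]; exists c, d; split=> // t td.
by rewrite -fg h.
Qed.

Lemma bigO0D n f g : bigO0 n f -> bigO0 n g -> bigO0 n (fun t => f t + g t).
Proof.
move=> [c [d [c0 d0 d1 hf]]] [c' [d' [c0' d0' d1' hg]]].
exists (c + c'), (Num.min d d'); split.
- exact: addr_ge0.
- by rewrite lt_min d0.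
- by rewrite ge_min d1.
move=> t; rewrite le_min => /andP[td td'].
by rewrite mulrDl (le_trans (ler_normD _ _)) // lerD ?hf ?hg.
Qed.

Lemma bigO0M n m f g :
  bigO0 n f -> bigO0 m g -> bigO0 (n + m) (fun t => f t * g t).
Proof.
move=> [c [d [c0 d0 d1 hf]]] [c' [d' [c0' d0' d1' hg]]].
exists (c * c'), (Num.min d d'); split.
- exact: mulr_ge0.
- by rewrite lt_min d0.
- by rewrite ge_min d1.
move=> t; rewrite le_min => /andP[td td'].
by rewrite exprD mulrACA normrM ler_pM ?hf ?hg.
Qed.

(** As [m > 0] and [|t| <= 1], [|g t| <= c' |t|]; the radius [d / (c' + 1)] then keeps [g t] where
    the bound on [f] holds. *)
Lemma bigO0_comp n m f g : (0 < m)%N ->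
  bigO0 n f -> bigO0 m g -> bigO0 (m * n) (fun t => f (g t)).
Proof.
move=> m0 [c [d [c0 d0 d1 hf]]] [c' [d' [c0' d0' d1' hg]]].
have c1 : 0 < c' + 1 by rewrite ltr_wpDl.
exists (c * c' ^+ n), (Num.min d' (d / (c' + 1))); split.
- by rewrite mulr_ge0 // exprn_ge0.
- by rewrite lt_min d0' divr_gt0.
- by rewrite ge_min d1'.
move=> t; rewrite le_min => /andP[td' td].
have gt : `|g t| <= c' * `|t| ^+ m by exact: hg.
have gd : `|g t| <= d.
  apply: le_trans gt _; move: td; rewrite ler_pdivlMr // mulrC.
  apply: le_trans; apply: ler_pM; rewrite ?exprn_ge0 ?lerDl //.
  by rewrite -[leRHS]expr1; apply: ler_wiXn2l => //; apply: le_trans td' d1'.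
apply: le_trans (hf _ gd) _; rewrite -mulrA ler_wpM2l //.
by rewrite exprM -exprMn; apply: lerXn2r; rewrite ?nnegrE // mulr_ge0 ?exprn_ge0.
Qed.

Lemma bigO0W m n f : (m <= n)%N -> bigO0 n f -> bigO0 m f.
Proof.
move=> mn [c [d [c0 d0 d1 hf]]]; exists c, d; split=> // t td.
apply: le_trans (hf t td) _; rewrite ler_wpM2l //.
by apply: ler_wiXn2l => //; apply: le_trans td d1.
Qed.

Lemma bigO0_monom n c : bigO0 n (fun t => c * t ^+ n).
Proof.
exists `|c|, 1; split=> // t _.
by rewrite normrM normrX.
Qed.

Lemma bigO0_cst c : bigO0 0 (fun=> c).
Proof. by apply: (bigO0_ext _ (bigO0_monom 0 c)) => t; rewrite expr0 mulr1. Qed.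

Lemma bigO0Z n c f : bigO0 n f -> bigO0 n (fun t => c * f t).
Proof. exact: (bigO0M (bigO0_cst c)). Qed.

Lemma bigO0_taylor n r :
  bigO0 n (fun u => (1 + u) `^ r - (binom_poly r n).[u]).
Proof.
have [c h] := powR_taylor n r; exists `|c|, 2^-1; split=> //; try lra.
by move=> t /h; move/le_trans; apply; rewrite ler_wpM2r ?exprn_ge0 // ler_norm.
Qed.

Lemma bigO0_taylor_abs n r :
  bigO0 n (fun u => `|1 + u| `^ r - (binom_poly r n).[u]).
Proof.
have [c [d [c0 d0 d1 h]]] := bigO0_taylor n r; exists c, d; split=> // t td.
rewrite [`|1 + t|]ger0_norm ?h //.
by move: (le_trans td d1); rewrite ler_norml => /andP[]; lra.
Qed.

End BigO.

(** * Fourth-order expansion of the moments of a two-valued variable *)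

Section BernoulliMean.
Variable R : realType.
Implicit Types (a c d p r t u x : R).

(* [E |1 + t X|^p] for the centred variable [X] with [P (X = a - 1) = a] and
   [P (X = a) = 1 - a]. *)
Definition bmean p a t :=
  a * `|1 - (1 - a) * t| `^ p + (1 - a) * `|1 + a * t| `^ p.

Definition bcoef2 p a := (p - 1) * (a * (1 - a)) / 2.
Definition bcoef3 p a := (p - 1) * (p - 2) * (a * (1 - a)) * (2 * a - 1) / 6.
Definition bcoef4 p a :=
  (p - 1) * (p - 2) * (p - 3) * (a * (1 - a)) * (1 - 3 * (a * (1 - a))) / 24
  - (p - 1) ^+ 3 * (a * (1 - a)) ^+ 2 / 8.

(** The linear terms cancel because [X] is centred. With [A = a (1 - a)] its next moments are [A],
    [A (2 a - 1)] and [A (1 - 3 A)]. *)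
Lemma bmean_expansion p a : bigO0 5 (fun t => bmean p a t -
  (1 + p * bcoef2 p a * t ^+ 2 + p * bcoef3 p a * t ^+ 3
   + p * (p - 1) * (p - 2) * (p - 3) * (a * (1 - a)) * (1 - 3 * (a * (1 - a))) / 24 * t ^+ 4)).
Proof.
have l c : bigO0 5 (fun t => `|1 + c * t| `^ p - (binom_poly p 5).[c * t]).
  exact: (bigO0_comp (isT : (0 < 1)%N) (bigO0_taylor_abs 5 p) (bigO0_monom 1 c)).
apply: bigO0_ext (bigO0D (bigO0Z a (l (a - 1))) (bigO0Z (1 - a) (l a))) => t.
rewrite !binom_poly5E /bmean /bcoef2 /bcoef3.
have -> : 1 + (a - 1) * t = 1 - (1 - a) * t by ring.
by field.
Qed.

Lemma bmean_root_expansion p a : p != 0 -> bigO0 5 (fun t => bmean p a t `^ p^-1 -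
  (1 + bcoef2 p a * t ^+ 2 + bcoef3 p a * t ^+ 3 + bcoef4 p a * t ^+ 4)).
Proof.
move=> p0.
pose e4 := p * (p - 1) * (p - 2) * (p - 3) * (a * (1 - a)) * (1 - 3 * (a * (1 - a))) / 24.
pose z t := bmean p a t - 1.
have hz : bigO0 5 (fun t => z t - (p * bcoef2 p a * t ^+ 2 + p * bcoef3 p a * t ^+ 3 + e4 * t ^+ 4)).
  by apply: bigO0_ext (bmean_expansion p a) => t; rewrite /z /e4; ring.
have hz3 : bigO0 3 (fun t => z t - p * bcoef2 p a * t ^+ 2).
  apply: bigO0_ext (bigO0D (bigO0W (isT : (3 <= 5)%N) hz) (bigO0D (bigO0_monom 3 (p * bcoef3 p a))
    (bigO0W (isT : (3 <= 4)%N) (bigO0_monom 4 e4)))) => t.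
  by rewrite /=; ring.
have hz2 : bigO0 2 z.
  apply: bigO0_ext (bigO0D (bigO0W (isT : (2 <= 3)%N) hz3) (bigO0_monom 2 (p * bcoef2 p a))) => t.
  by rewrite /=; ring.
have hzz : bigO0 5 (fun t => z t ^+ 2 - (p * bcoef2 p a) ^+ 2 * t ^+ 4).
  apply: bigO0_ext (bigO0M hz3 (bigO0D hz2 (bigO0_monom 2 (p * bcoef2 p a)))) => t.
  by rewrite /=; ring.
(* As [z] has order 2, the expansion of [(1 + z)^(1/p)] may stop after [z^2]: the error has order
   6. *)
have hc := bigO0W (isT : (5 <= 2 * 3)%N)
   (bigO0_comp (isT : (0 < 2)%N) (bigO0_taylor 3 p^-1) hz2).
apply: bigO0_ext (bigO0D hc (bigO0D (bigO0Z p^-1 hz)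
   (bigO0Z (p^-1 * (p^-1 - 1) / 2) hzz))) => t.
rewrite /= binom_poly3E.
have -> : 1 + z t = bmean p a t by rewrite /z; ring.
by rewrite /bcoef4 /bcoef3 /bcoef2 /e4; field.
Qed.

End BernoulliMean.

(** * Comparison of Taylor coefficients in the critical case *)

Section Comparison.
Variable R : realType.
Implicit Types (a b c d p q r s t u x : R) (f g h : R -> R).

Lemma bigO0_lead_ge0 n c f : (forall t, 0 <= f t) ->
  bigO0 n.+1 (fun t => f t - c * t ^+ n) -> 0 <= c.
Proof.
move=> f0 [k [d [k0 d0 d1 h]]]; rewrite leNgt; apply/negP => c0.
(* This [t] makes the relative error [k * t] smaller than [- c], so [f t] would be negative. *)
pose t := Num.min d (- c / (2 * (k + 1))).
have k1 : 0 < 2 * (k + 1) by rewrite mulr_gt0 // ltr_wpDl.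
have t0 : 0 < t by rewrite lt_min d0 divr_gt0 // oppr_gt0.
have td : `|t| <= d by rewrite gtr0_norm // ge_min lexx.
have tc : t * (2 * (k + 1)) <= - c.
  by rewrite -ler_pdivlMr // ge_min lexx orbT.
have := le_trans (ler_norm _) (h t td); rewrite gtr0_norm // exprS mulrA => h1.
have tn : 0 < t ^+ n by exact: exprn_gt0.
have h2 : 0 < (- c - k * t) * t ^+ n.
  rewrite mulr_gt0 // subr_gt0; apply: lt_le_trans tc.
  by rewrite mulrC ltr_pM2l //; lra.
move: h2; rewrite mulrBl mulNr => h2; have := f0 t.
lra.
Qed.

(** Replacing [t] by [- t] changes the sign of an odd leading term, and both signs must be
    nonnegative. *)
Lemma bigO0_lead_odd_eq0 n c f : odd n -> (forall t, 0 <= f t) ->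
  bigO0 n.+1 (fun t => f t - c * t ^+ n) -> c = 0.
Proof.
move=> on f0 hf; apply/eqP; rewrite eq_le (bigO0_lead_ge0 f0 hf) andbT -oppr_ge0.
apply: (@bigO0_lead_ge0 n (- c) (fun t => f (- t))) => // .
have [k [d [k0 d0 d1 h]]] := hf; exists k, d; split=> // t td.
have := h (- t); rewrite !normrN => /(_ td).
by rewrite exprNn -signr_odd on expr1 mulN1r mulrN mulNr.
Qed.

(** The difference of the two roots is nonnegative and has no quadratic term. Its cubic term is odd,
    hence zero, and the quartic term then leads. *)
Lemma bmean_compare p q a b l : p != 0 -> q != 0 ->
  (forall t, bmean q b (l * t) `^ q^-1 <= bmean p a t `^ p^-1) ->
  l ^+ 2 * bcoef2 q b = bcoef2 p a ->
  l ^+ 3 * bcoef3 q b = bcoef3 p a /\ l ^+ 4 * bcoef4 q b <= bcoef4 p a.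
Proof.
move=> p0 q0 hle e2.
pose f t := bmean p a t `^ p^-1 - bmean q b (l * t) `^ q^-1.
have f0 t : 0 <= f t by rewrite subr_ge0.
have hf : bigO0 5 (fun t => f t - ((bcoef3 p a - l ^+ 3 * bcoef3 q b) * t ^+ 3
    + (bcoef4 p a - l ^+ 4 * bcoef4 q b) * t ^+ 4)).
  have hq := bigO0_comp (isT : (0 < 1)%N) (bmean_root_expansion b q0) (bigO0_monom 1 l).
  apply: bigO0_ext (bigO0D (bmean_root_expansion a p0) (bigO0Z (-1) hq)) => t.
  rewrite /f /= -e2.
  move: (bmean p a t `^ p^-1) (bmean q b (l * t) `^ q^-1) (bcoef2 q b) => X Y c2.
  by move: (bcoef3 p a) (bcoef3 q b) (bcoef4 p a) (bcoef4 q b) => *; ring.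
have e3 : bcoef3 p a - l ^+ 3 * bcoef3 q b = 0.
  apply: (@bigO0_lead_odd_eq0 3 _ f) => //.
  apply: bigO0_ext (bigO0D (bigO0W (isT : (4 <= 5)%N) hf)
    (bigO0_monom 4 (bcoef4 p a - l ^+ 4 * bcoef4 q b))) => t.
  by rewrite /=; ring.
split; first by apply/esym/eqP; rewrite -subr_eq0 e3.
rewrite -subr_ge0; apply: (@bigO0_lead_ge0 4 _ f) => //.
by apply: bigO0_ext hf => t; rewrite e3; ring.
Qed.

Lemma var_bounds a : 0 < a < 1 -> 0 < a * (1 - a) <= 4^-1.
Proof.
move=> /andP[a0 a1]; rewrite mulr_gt0 ?subr_gt0 //= -subr_ge0.
have -> : 4^-1 - a * (1 - a) = (a - 2^-1) ^+ 2 by field.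
exact: sqr_ge0.
Qed.

(** Divide the cubic relation by the quadratic one: [bcoef3 p a] is
    [bcoef2 p a * (p - 2) * (2 * a - 1) / 3]. *)
Lemma critical_third p q a b l : 1 < p -> 0 < a < 1 ->
  l ^+ 2 * bcoef2 q b = bcoef2 p a ->
  l ^+ 3 * bcoef3 q b = bcoef3 p a ->
  (q - 2) * (2 * b - 1) * l = (p - 2) * (2 * a - 1).
Proof.
move=> p1 /var_bounds /andP[A0 _] e2 e3.
have c2 : bcoef2 p a != 0 by rewrite gt_eqF // /bcoef2; rewrite divr_gt0 // mulr_gt0 // subr_gt0.
apply: (mulfI c2); rewrite -[in LHS]e2.
have -> : bcoef2 p a * ((p - 2) * (2 * a - 1)) = 3 * bcoef3 p a.
  by rewrite /bcoef2 /bcoef3; field.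
by rewrite -e3 /bcoef2 /bcoef3; field.
Qed.

(* Eliminating [d] and [e] from the fourth-order condition by the third-order one
   [(q - 2) e l = (p - 2) d], with [d = 2a - 1], [d^2 = 1 - 4A] and [A = a (1 - a)]
   (same for [b, e, B]), leaves the impossible
   [l^2 (2 - q) + (p - 2) + 2 (p - q) (p - 1) A + 2 A - 2 l^2 B <= 0]. *)
Lemma critical_absurd p q a b l : 1 < q <= 2 -> 2 <= p -> q < p ->
  0 < a < 1 -> 0 < b < 1 ->
  l ^+ 2 * bcoef2 q b = bcoef2 p a ->
  l ^+ 3 * bcoef3 q b = bcoef3 p a ->
  l ^+ 4 * bcoef4 q b <= bcoef4 p a -> False.
Proof.
move=> /andP[q1 q2] p2 qp a01 b01 e2 e3 e4.
have p1 : 1 < p by lra.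
have := critical_third p1 a01 e2 e3.
have /andP[A0 A4] := var_bounds a01.
have /andP[B0 B4] := var_bounds b01.
move: e2 e4; rewrite /bcoef2 /bcoef4.
have : (2 * a - 1) ^+ 2 = 1 - 4 * (a * (1 - a)) by ring.
have : (2 * b - 1) ^+ 2 = 1 - 4 * (b * (1 - b)) by ring.
move: (a * (1 - a)) (b * (1 - b)) (2 * a - 1) (2 * b - 1) A0 A4 B0 B4.
clear a01 b01 e3 => A B da db A0 A4 B0 B4 eb ea e2 e4 e3.
pose P := p - 1; pose Q := q - 1; pose L := l ^+ 2 * B.
have L0 : 0 <= L by rewrite mulr_ge0 ?sqr_ge0 // ltW.
have eM : L * Q = P * A.
  transitivity (l ^+ 2 * ((q - 1) * B / 2) * 2); first by rewrite /L /Q; field.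
  by rewrite e2 /P; field.
have M0 : 0 < P * A by rewrite mulr_gt0 // subr_gt0.
have sq : (Q - 1) ^+ 2 * (l ^+ 2 * (1 - 4 * B)) = (P - 1) ^+ 2 * (1 - 4 * A).
  have := congr1 (fun z => z ^+ 2) e3; rewrite !exprMn eb ea /P /Q => h.
  transitivity ((q - 2) ^+ 2 * (1 - 4 * B) * l ^+ 2); first by ring.
  by rewrite h; ring.
(* The fourth-order condition freed of the common positive factor [P * A / 24], where
   [P * A = L * Q]. *)
have h4 : l ^+ 2 * ((Q - 1) * (Q - 2) * (1 - 3 * B)) - 3 * Q * (P * A) <=
          (P - 1) * (P - 2) * (1 - 3 * A) - 3 * P * (P * A).
  rewrite -(ler_pM2l M0) -(ler_pM2r (_ : 0 < 24^-1)); last by rewrite invr_gt0.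
  have -> : P * A * ((P - 1) * (P - 2) * (1 - 3 * A) - 3 * P * (P * A)) / 24 =
     (p - 1) * (p - 2) * (p - 3) * A * (1 - 3 * A) / 24 - (p - 1) ^+ 3 * A ^+ 2 / 8.
    by rewrite /P; field.
  apply: le_trans e4; rewrite le_eqVlt; apply/orP; left; apply/eqP.
  by rewrite -eM /L /Q; field.
have {h4} h5 : l ^+ 2 * (1 - Q) + (P - 1) + 2 * (P * A) * (P - Q) - 2 * L + 2 * A <= 0.
  rewrite -subr_ge0 in h4; rewrite -oppr_ge0.
  have -> : - (l ^+ 2 * (1 - Q) + (P - 1) + 2 * (P * A) * (P - Q) - 2 * L + 2 * A) =
    (P - 1) * (P - 2) * (1 - 3 * A) - 3 * P * (P * A)
     - (l ^+ 2 * ((Q - 1) * (Q - 2) * (1 - 3 * B)) - 3 * Q * (P * A))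
     + ((Q - 1) ^+ 2 * (l ^+ 2 * (1 - 4 * B)) - (P - 1) ^+ 2 * (1 - 4 * A))
     - (Q + 1) * (P * A - L * Q) by rewrite /L; ring.
  by rewrite sq eM !subrr mulr0 addr0 subr0.
(* By [h11], [h12] and [eM], the left side of [h5] is the sum of the quantities in [h6] and [h7],
   twice that in [h8], and [2 (L - A)]. It is positive, since [A <= P * A = L * Q <= L]. *)
have h6 : 0 <= (1 - Q) * (l ^+ 2 * (1 - 4 * B)).
  by rewrite mulr_ge0 ?(mulr_ge0 (sqr_ge0 _)) // /Q; lra.
have h7 : 0 <= (P - 1) * (1 - 4 * A).
  by rewrite mulr_ge0 // /P; lra.
have h8 : 0 < P * A * (P - Q) by rewrite mulr_gt0 // /P /Q; lra.
have h9 : L * Q <= L by rewrite ler_piMr // /Q; lra.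
have h10 : A <= P * A by rewrite ler_peMl ?(ltW A0) // /P; lra.
have h11 : l ^+ 2 * (1 - Q) = (1 - Q) * (l ^+ 2 * (1 - 4 * B)) + 4 * (L - L * Q).
  by rewrite /L; ring.
have h12 : (P - 1) * (1 - 4 * A) = (P - 1) - 4 * (P * A) + 4 * A by ring.
rewrite h11 eM in h5; rewrite eM in h9; rewrite h12 in h7.
clear -h5 h6 h7 h8 h9 h10.
move: h5 h6 h7 h8 h9 h10; rewrite -mulrA.
move: (P * A * (P - Q)) (P * A) ((1 - Q) * (l ^+ 2 * (1 - 4 * B))) => X Y Z.
lra.
Qed.

(** For equal exponents the cubic relation is [(2 b - 1) l = 2 a - 1] and the quadratic one
    [l^2 b (1 - b) = a (1 - a)]. As [(2 b - 1)^2 + 4 b (1 - b) = 1], they give [l^2 = 1]; then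
    [b = a], or [l = -1] and [b = 1 - a], which merely exchanges the two values of the variable. *)
Lemma critical_same p a b l : 1 < p -> p != 2 -> 0 < a < 1 ->
  l ^+ 2 * bcoef2 p b = bcoef2 p a ->
  l ^+ 3 * bcoef3 p b = bcoef3 p a ->
  forall t, bmean p b (l * t) = bmean p a t.
Proof.
move=> p1 p2 a01 e2 e3 t.
have p10 : p - 1 != 0 by rewrite gt_eqF // subr_gt0.
have := critical_third p1 a01 e2 e3; rewrite -mulrA => /mulfI.
rewrite subr_eq0 => /(_ p2) dl.
have eA : l ^+ 2 * (b * (1 - b)) = a * (1 - a).
  apply: (mulfI p10).
  transitivity (l ^+ 2 * bcoef2 p b * 2); first by rewrite /bcoef2; field.
  by rewrite e2 /bcoef2; field.
have : l ^+ 2 = 1.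
  have := congr1 (fun z => z ^+ 2) dl; rewrite exprMn => h.
  transitivity ((2 * b - 1) ^+ 2 * l ^+ 2 + 4 * (l ^+ 2 * (b * (1 - b)))); first by ring.
  by rewrite h eA; ring.
move=> /eqP; rewrite sqrf_eq1 => /orP[] /eqP l1; move: dl; rewrite l1 => dl.
  have -> : b = a by lra.
  by rewrite mul1r.
have -> : b = 1 - a by lra.
rewrite /bmean.
have -> : 1 - (1 - (1 - a)) * (-1 * t) = 1 + a * t by ring.
have -> : 1 + (1 - a) * (-1 * t) = 1 - (1 - a) * t by ring.
ring.
Qed.

End Comparison.

(** * Functions with a leading term of real order *)

Section LeadingOrder.
Variable R : realType.
Implicit Types (c d e m n s t : R) (f g : R -> R).

(** This is [f t = 1 + c |t|^m + o(|t|^m)]. The exponent is real, since a degenerate vector gives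
    [m = p]. *)
Definition leading f c m := forall e, 0 < e -> exists2 d : R, 0 < d &
  forall t, `|t| <= d -> `|f t - (1 + c * `|t| `^ m)| <= e * `|t| `^ m.

Lemma powR_small k e : 0 < k -> 0 < e ->
  exists2 d : R, 0 < d & forall t, 0 <= t <= d -> t `^ k <= e.
Proof.
move=> k0 e0; exists (e `^ k^-1) => [|t /andP[t0 td]]; first exact: powR_gt0.
have := ge0_ler_powR (ltW k0) _ _ td; rewrite !nnegrE t0 powR_ge0 => /(_ isT isT).
by rewrite -powRrM mulVf ?gt_eqF // powRr1 // ltW.
Qed.

Lemma leading_lower f c m : leading f c m -> forall k, k < c ->
  exists2 d : R, 0 < d & forall t, `|t| <= d -> 1 + k * `|t| `^ m <= f t.
Proof.
move=> hf k kc; have [d d0 h] := hf (c - k) (etrans (subr_gt0 _ _) kc).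
exists d => // t /h; rewrite ler_norml => /andP[h1 _].
by move: h1; move: (`|t| `^ m) => T; rewrite mulrBl; lra.
Qed.

Lemma leading_upper f c m : leading f c m -> forall k, c < k ->
  exists2 d : R, 0 < d & forall t, `|t| <= d -> f t <= 1 + k * `|t| `^ m.
Proof.
move=> hf k kc; have [d d0 h] := hf (k - c) (etrans (subr_gt0 _ _) kc).
exists d => // t /h; rewrite ler_norml => /andP[_ h1].
by move: h1; move: (`|t| `^ m) => T; rewrite mulrBl; lra.
Qed.

Section Compare.
Variables (f g : R -> R) (c c' m n : R).
Hypotheses (hf : leading f c m) (hg : leading g c' n).
Hypotheses (m0 : 0 < m) (n0 : 0 < n) (c0 : 0 < c) (c'0 : 0 < c').

(** The margins [k' < c'] and [c < k] absorb both error terms, which leaves an inequality between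
    pure powers of small [t]. *)
Lemma leading_compare s k k' : k' < c' -> c < k ->
  (forall t, g (s * t) <= f t) ->
  exists2 d : R, 0 < d & forall t, 0 <= t <= d ->
    k' * `|s| `^ n * t `^ n <= k * t `^ m.
Proof.
move=> kc' kc h.
have [d1 d10 h1] := leading_lower hg kc'.
have [d2 d20 h2] := leading_upper hf kc.
have s1 : 0 < `|s| + 1 by rewrite ltr_wpDl.
exists (Num.min d2 (d1 / (`|s| + 1))); first by rewrite lt_min d20 divr_gt0.
move=> t; rewrite le_min ler_pdivlMr // => /and3P[t0 td2 td1].
have := h2 t; rewrite ger0_norm // => /(_ td2) h3.
have := h1 (s * t); rewrite normrM (ger0_norm t0) powRM // => h4.
have {}h4 : 1 + k' * (`|s| `^ n * t `^ n) <= g (s * t).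
  by apply: h4; apply: le_trans td1; rewrite mulrC ler_wpM2l // lerDl.
by have := le_trans (le_trans h4 (h t)) h3; rewrite lerD2l mulrA.
Qed.

(** Dividing by [t^n] bounds a positive multiple of [|s|^n] by a multiple of [t^(m - n)], which
    tends to 0. *)
Lemma leading_lt_eq0 s : n < m -> (forall t, g (s * t) <= f t) -> s = 0.
Proof.
move=> nm h; apply/eqP/negPn/negP => s0.
have k'0 : 0 < c' / 2 by rewrite divr_gt0.
have k'c : c' / 2 < c' by rewrite ltr_pdivrMr // mulr_natr mulr2n ltrDl.
have kc : c < c + 1 by rewrite ltrDl.
have k0 : 0 < c + 1 by rewrite ltr_wpDl // ltW.
have [d d0 hd] := leading_compare k'c kc h.
have sn : 0 < `|s| `^ n by rewrite powR_gt0 // normr_gt0.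
have e0 : 0 < c' / 2 * `|s| `^ n / (c + 1) / 2 by rewrite !divr_gt0 // mulr_gt0.
have mn : 0 < m - n by rewrite subr_gt0.
have [d' d'0 hd'] := powR_small mn e0.
pose t := Num.min d d'.
have t0 : 0 < t by rewrite lt_min d0.
have := hd t; rewrite ge_min lexx (ltW t0) => /(_ isT).
have := hd' t; rewrite ge_min lexx orbT (ltW t0) => /(_ isT).
rewrite ler_pdivlMr // ler_pdivlMr // => h1.
have -> : t `^ m = t `^ (m - n) * t `^ n by rewrite -powRD ?subrK // gt_eqF // implybT.
rewrite mulrA ler_pM2r ?powR_gt0 // => h2.
have : 0 < t `^ (m - n) * (c + 1) by rewrite mulr_gt0 // powR_gt0.
lra.
Qed.

Lemma leading_eq_le s : n = m -> (forall t, g (s * t) <= f t) ->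
  c' * `|s| `^ m <= c.
Proof.
move=> nm h; rewrite leNgt; apply/negP => hc.
(* Half of what the margins could consume: [(c' - e) |s|^m] still exceeds [c + e], by
   [e (1 + |s|^m)]. *)
pose e := (c' * `|s| `^ m - c) / (2 * (1 + `|s| `^ m)).
have S0 : 0 <= `|s| `^ m by exact: powR_ge0.
have e0 : 0 < e by rewrite divr_gt0 ?subr_gt0 // mulr_gt0 // ltr_pwDl.
have ee : e * (2 * (1 + `|s| `^ m)) = c' * `|s| `^ m - c.
  by rewrite divfK // gt_eqF // mulr_gt0 // ltr_pwDl.
have k'c : c' - e < c' by rewrite gtrBl.
have kc : c < c + e by rewrite ltrDl.
have [d d0 hd] := leading_compare k'c kc h.
have := hd d; rewrite lexx (ltW d0) => /(_ isT).
rewrite nm ler_pM2r ?powR_gt0 //.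
nra.
Qed.

(** For small [t], a term of order [n > m] is below one of order [m], uniformly for
    [|s'| <= |s| + 1]. *)
Lemma leading_slack_gt s : m < n ->
  exists d e : R, [/\ 0 < d, 0 < e &
    forall s' t, `|s' - s| <= e -> `|t| <= d -> g (s' * t) <= f t].
Proof.
move=> mn.
have k'c : c' < c' + 1 by rewrite ltrDl.
have kc : c / 2 < c by rewrite ltr_pdivrMr // mulr_natr mulr2n ltrDl.
have [d1 d10 h1] := leading_upper hg k'c.
have [d2 d20 h2] := leading_lower hf kc.
pose S := `|s| + 1.
have S0 : 0 < S by rewrite ltr_wpDl.
have nm0 : 0 < n - m by rewrite subr_gt0.
have k0 : 0 < (c' + 1) * S `^ n by rewrite mulr_gt0 ?powR_gt0 // ltr_wpDl // ltW.
have e0 : 0 < (c / 2) / ((c' + 1) * S `^ n) by rewrite !divr_gt0.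
have [d3 d30 h3] := powR_small nm0 e0.
exists (Num.min (Num.min d2 d3) (d1 / S)), 1; split=> //.
  by rewrite !lt_min d20 d30 divr_gt0.
move=> s' t ss; rewrite !le_min ler_pdivlMr // => /andP[/andP[td2 td3] td1].
have sS : `|s'| <= S.
  by rewrite /S -{1}(subrK s s') (le_trans (ler_normD _ _)) // addrC lerD2l.
have td1' : `|s' * t| <= d1 by rewrite normrM mulrC (le_trans _ td1) // ler_wpM2l.
apply: le_trans (h1 _ td1') (le_trans _ (h2 _ td2)).
rewrite lerD2l normrM powRM //.
have [->|t0] := eqVneq t 0.
  by rewrite normr0 powR0 ?gt_eqF // powR0 ?gt_eqF // !mulr0.
have -> : `|t| `^ n = `|t| `^ (n - m) * `|t| `^ m.
  by rewrite -powRD ?subrK // normr_eq0 t0 implybT.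
have := h3 `|t|; rewrite normr_ge0 td3 => /(_ isT); rewrite ler_pdivlMr // => h4.
rewrite !mulrA ler_wpM2r ?powR_ge0 // (le_trans _ h4) // [leRHS]mulrC ler_wpM2r ?powR_ge0 //.
rewrite ler_wpM2l //; first by rewrite ltW // ltr_wpDl // ltW.
by apply: ge0_ler_powR; rewrite ?nnegrE ?(ltW n0) ?(ltW S0).
Qed.

Lemma leading_slack_eq s : n = m -> c' * `|s| `^ m < c ->
  exists d e : R, [/\ 0 < d, 0 < e &
    forall s' t, `|s' - s| <= e -> `|t| <= d -> g (s' * t) <= f t].
Proof.
move=> nm hc.
(* [W] is the midpoint between [|s|^m] and the critical value [c / c']. Every [s'] with
   [|s'| <= S = W^(1/m)] stays subcritical. *)
pose W := (c / c' + `|s| `^ m) / 2.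
have hW : `|s| `^ m < c / c' by rewrite ltr_pdivlMr // mulrC.
have W0 : 0 < W by rewrite divr_gt0 // ltr_pwDl ?powR_ge0 // divr_gt0.
have hW1 : `|s| `^ m < W by rewrite /W; lra.
have hW2 : W < c / c' by rewrite /W; lra.
pose S := W `^ m^-1.
have SW : S `^ m = W by rewrite -powRrM mulVf ?gt_eqF // powRr1 // ltW.
have S0 : 0 < S by exact: powR_gt0.
have sS : `|s| < S.
  rewrite ltNge; apply/negP => Ss.
  have := ge0_ler_powR (ltW m0) _ _ Ss; rewrite !nnegrE normr_ge0 (ltW S0).
  by move=> /(_ isT isT); rewrite SW leNgt hW1.
have hW3 : c' * W < c by move: hW2; rewrite ltr_pdivlMr // mulrC.
(* With this [e], [(c' + e / 2) W <= c - e / 2], so perturbing each coefficient by [e / 2] preserves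
   the order. *)
pose e := (c - c' * W) / (1 + W).
have W1 : 0 < 1 + W by rewrite ltr_wpDl.
have e0 : 0 < e by rewrite divr_gt0 // subr_gt0.
have ee : e * (1 + W) = c - c' * W by rewrite divfK // gt_eqF.
have e20 : 0 < e / 2 by rewrite divr_gt0.
have k'c : c' < c' + e / 2 by rewrite ltrDl.
have kc : c - e / 2 < c by rewrite gtrBl.
have [d1 d10 h1] := leading_upper hg k'c.
have [d2 d20 h2] := leading_lower hf kc.
exists (Num.min d2 (d1 / S)), (S - `|s|); split=> //.
- by rewrite lt_min d20 divr_gt0.
- by rewrite subr_gt0.
move=> s' t ss; rewrite le_min ler_pdivlMr // => /andP[td2 td1].
have s'S : `|s'| <= S.
  by move: ss; rewrite lerBrDr; apply: le_trans; rewrite -{1}(subrK s s') ler_normD.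
have td1' : `|s' * t| <= d1 by rewrite normrM mulrC (le_trans _ td1) // ler_wpM2l.
apply: le_trans (h1 _ td1') (le_trans _ (h2 _ td2)).
rewrite lerD2l normrM powRM // nm mulrA ler_wpM2r ?powR_ge0 //.
apply: (@le_trans _ _ ((c' + e / 2) * W)).
  rewrite ler_wpM2l ?(addr_ge0 (ltW c'0) (ltW e20)) // -SW.
  by apply: ge0_ler_powR; rewrite ?nnegrE ?(ltW m0) ?(ltW S0).
have : 0 <= e * W by rewrite mulr_ge0 // ltW.
by clearbody e W; lra.
Qed.

End Compare.
End LeadingOrder.

(** * The norm along the tangent line to the unit sphere *)

Section TangentCurve.
Variable R : realType.
Local Open Scope classical_set_scope.
Local Open Scope ring_scope.
Implicit Types (p q s t : R) (x y u w : 'cV[R]_2).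

(** By the triangle inequality the function is Lipschitz with constant [lpnorm p w]. *)
Lemma lpnorm_line_continuous p u w : 1 < p ->
  continuous (fun t : R => lpnorm p (u + t *: w)).
Proof.
move=> p1 t; have p0 : 0 < p := lt_trans ltr01 p1.
have lip a b : lpnorm p (u + a *: w) <= lpnorm p (u + b *: w) + `|b - a| * lpnorm p w.
  have -> : u + a *: w = (u + b *: w) + (a - b) *: w.
    by rewrite -addrA -scalerDl addrCA subrr addr0.
  by rewrite (le_trans (ler_lpnormD _ _ p1)) // lpnormZ // distrC.
apply/cvgrPdist_le => e e0.
have K0 : 0 < lpnorm p w + 1 by rewrite ltr_wpDl ?lpnorm_ge0.
near=> z.
have tz : `|t - z| < e / (lpnorm p w + 1).
  by near: z; apply: (nbhsx_ballx t); rewrite divr_gt0.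
have te : `|t - z| * lpnorm p w <= e.
  move: tz; rewrite ltr_pdivlMr // => /ltW; apply: le_trans.
  by rewrite ler_wpM2l // lerDl.
have h1 := lip z t; have h2 := lip t z; rewrite [`|z - t|]distrC in h2.
rewrite ler_norml; move: (_ * lpnorm p w) te h1 h2 => X.
move: (lpnorm _ _) (lpnorm _ _) => Y Z *; apply/andP; split; lra.
Unshelve. all: by end_near.
Qed.

(** For a unit vector [x] it spans the kernel of the support functional [spow (p - 1) x]. *)
Definition tangent p x : 'cV[R]_2 := perp (spow (p - 1) x).

Definition curve p x t := lpnorm p (x + t *: tangent p x).

Definition nondeg x := x 0 0 * x 1 0 != 0.

Lemma curveE p x t : curve p x t =
  (`|x 0 0 - t * sgpow (p - 1) (x 1 0)| `^ p +
   `|x 1 0 + t * sgpow (p - 1) (x 0 0)| `^ p) `^ p^-1.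
Proof. by rewrite /curve /lpnorm !mxE /= -!/(sgpow _ _) mulrN. Qed.

(** Factoring each coordinate of [x] out of the corresponding term turns the norm into a mean with
    weights [|x_1|^p] and [|x_2|^p], in the parameter [t / (x_1 x_2)]. *)
Lemma curve_nondeg p x t : 1 < p -> lpnorm p x = 1 -> nondeg x ->
  curve p x t = bmean p (`|x 0 0| `^ p) (t / (x 0 0 * x 1 0)) `^ p^-1.
Proof.
move=> p1 x1; rewrite /nondeg mulf_eq0 negb_or => /andP[n0 n1].
have p0 : 0 < p := lt_trans ltr01 p1.
have {x1} x1 := (lpnorm_eq1 x p0).1 x1.
rewrite curveE; congr (_ `^ _); rewrite /bmean.
have e1 : 1 - `|x 0 0| `^ p = `|x 1 0| `^ p by rewrite -x1 /psum; ring.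
rewrite e1; congr (_ + _).
  rewrite -powRM // -normrM; congr (`|_| `^ _).
  rewrite -(mulr_sgpow _ p0); move: n0 n1; move: (sgpow _ _) => g; move: (x 0 0) (x 1 0) => a b a0 b0.
  by field; rewrite a0 b0.
rewrite -powRM // -normrM; congr (`|_| `^ _).
rewrite -(mulr_sgpow _ p0); move: n0 n1; move: (sgpow _ _) => g; move: (x 0 0) (x 1 0) => a b a0 b0.
by field; rewrite a0 b0.
Qed.

Lemma curve_deg p x t : 1 < p -> lpnorm p x = 1 -> ~~ nondeg x ->
  curve p x t = (1 + `|t| `^ p) `^ p^-1.
Proof.
move=> p1 x1; rewrite /nondeg negbK => ab.
have p0 : 0 < p := lt_trans ltr01 p1.
have {x1} := (lpnorm_eq1 x p0).1 x1.
have pow1 (a : R) : `|a| `^ p = 1 -> `|a| = 1.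
  by move=> h; apply: (powR_injective p0); rewrite ?nnegrE // h powR1.
have p10 : p - 1 != 0 by rewrite subr_eq0 gt_eqF.
have pow0 : 0 `^ p = 0 :> R by rewrite powR0 // gt_eqF.
rewrite curveE /psum; move: ab; move: (x 0 0) (x 1 0) => a b.
rewrite mulf_eq0 => /orP[]/eqP -> .
  rewrite normr0 pow0 add0r => /pow1 b1.
  have -> : b + t * sgpow (p - 1) 0 = b by rewrite sgpow0 mulr0 addr0.
  have -> : `|0 - t * sgpow (p - 1) b| = `|t|.
    by rewrite sub0r normrN normrM normr_sgpow // b1 powR1 mulr1.
  by rewrite b1 powR1 addrC.
rewrite normr0 pow0 addr0 => /pow1 a1.
have -> : a - t * sgpow (p - 1) 0 = a by rewrite sgpow0 mulr0 subr0.
have -> : `|0 + t * sgpow (p - 1) a| = `|t|.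
  by rewrite add0r normrM normr_sgpow // a1 powR1 mulr1.
by rewrite a1 powR1.
Qed.

(** With [curve_coef], the exponent [m] and the constant [c] in the expansion of the norm of
    [x + t v], for a unit vector [x] with tangent [v]. *)
Definition curve_order p x := if nondeg x then 2 else p.

Definition curve_coef p x :=
  if nondeg x then bcoef2 p (`|x 0 0| `^ p) / (x 0 0 * x 1 0) ^+ 2 else p^-1.

Lemma curve_order_gt0 p x : 1 < p -> 0 < curve_order p x.
Proof. by rewrite /curve_order; case: ifP => // _; apply: lt_trans. Qed.

Lemma nondeg_itv p x : 1 < p -> lpnorm p x = 1 -> nondeg x ->
  0 < `|x 0 0| `^ p < 1.
Proof.
move=> p1 x1; rewrite /nondeg mulf_eq0 negb_or => /andP[n0 n1].
have p0 : 0 < p := lt_trans ltr01 p1.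
have <- := (lpnorm_eq1 x p0).1 x1.
by rewrite /psum ltrDl !powR_gt0 ?normr_gt0.
Qed.

Lemma bcoef2_gt0 p (a : R) : 1 < p -> 0 < a < 1 -> 0 < bcoef2 p a.
Proof.
by move=> p1 /var_bounds /andP[a0 _]; rewrite /bcoef2 divr_gt0 // mulr_gt0 // subr_gt0.
Qed.

Lemma curve_coef_gt0 p x : 1 < p -> lpnorm p x = 1 -> 0 < curve_coef p x.
Proof.
move=> p1 x1; rewrite /curve_coef; case: ifP => nx; last by rewrite invr_gt0 (lt_trans _ p1).
by rewrite divr_gt0 ?bcoef2_gt0 ?nondeg_itv // exprn_even_gt0.
Qed.

Lemma bigO0_leading (f : R -> R) c :
  bigO0 3 (fun t => f t - (1 + c * t ^+ 2)) -> leading f c 2.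
Proof.
move=> [k [d [k0 d0 d1 h]]] e e0.
have k1 : 0 < k + 1 by rewrite ltr_wpDl.
exists (Num.min d (e / (k + 1))); first by rewrite lt_min d0 divr_gt0.
move=> t; rewrite le_min ler_pdivlMr // => /andP[td te].
have -> : `|t| `^ 2 = t ^+ 2 by rewrite -[2]/(2%:R) powR_mulrn // real_normK ?num_real.
apply: le_trans (h t td) _; rewrite exprS mulrA real_normK ?num_real //.
by rewrite ler_wpM2r ?sqr_ge0 // (le_trans _ te) // mulrC ler_wpM2l // lerDl.
Qed.

(** First-order expansion of [(1 + T)^(1/p)] at [T = |t|^p]; the error of order [T^2] is
    [o(|t|^p)]. *)
Lemma leading_powR p : 1 < p ->
  leading (fun t => (1 + `|t| `^ p) `^ p^-1) p^-1 p.
Proof.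
move=> p1 e e0; have p0 : 0 < p := lt_trans ltr01 p1.
have [k [d [k0 d0 d1 h]]] := bigO0_taylor 2 p^-1.
have k1 : 0 < k + 1 by rewrite ltr_wpDl.
have d'0 : 0 < Num.min d (e / (k + 1)) by rewrite lt_min d0 divr_gt0.
have [d' d'p hd'] := powR_small p0 d'0; exists d' => // t td.
have := hd' `|t|; rewrite normr_ge0 td => /(_ isT).
have := h (`|t| `^ p); have := powR_ge0 `|t| p.
move: (`|t| `^ p) => T T0; rewrite ger0_norm // le_min ler_pdivlMr // => {}h /andP[Td Te].
have := h Td; rewrite horner_poly !big_ord_recr big_ord0 /= expr0 expr1 !mulr1 add0r divr1.
move=> /le_trans; apply; rewrite expr2 mulrA ler_wpM2r //.
by rewrite (le_trans _ Te) // mulrC ler_wpM2l // lerDl.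
Qed.

Lemma curve_leading p x : 1 < p -> lpnorm p x = 1 ->
  leading (curve p x) (curve_coef p x) (curve_order p x).
Proof.
move=> p1 x1; have p0 : 0 < p := lt_trans ltr01 p1.
rewrite /curve_coef /curve_order; case: ifP => [nx|/negbT nx]; last first.
  move=> e e0; have [d d0 h] := leading_powR p1 e0; exists d; first exact: d0.
  move=> t td; rewrite curve_deg //; exact: h.
apply: bigO0_leading; pose a := `|x 0 0| `^ p; pose z := (x 0 0 * x 1 0)^-1.
have pN0 : p != 0 by rewrite gt_eqF.
have := bigO0_comp (isT : (0 < 1)%N) (bmean_root_expansion a pN0) (bigO0_monom 1 z).
move/(bigO0W (isT : (3 <= 1 * 5)%N)) => h.
apply: bigO0_ext (bigO0D h (bigO0D (bigO0_monom 3 (bcoef3 p a * z ^+ 3))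
  (bigO0W (isT : (3 <= 4)%N) (bigO0_monom 4 (bcoef4 p a * z ^+ 4))))) => t.
rewrite curve_nondeg // -/a /=.
have -> : t / (x 0 0 * x 1 0) = z * t ^+ 1 by rewrite expr1 mulrC.
have -> : bcoef2 p a / (x 0 0 * x 1 0) ^+ 2 = bcoef2 p a * z ^+ 2 by rewrite exprVn.
clearbody z; move: (bmean _ _ _ `^ _) (bcoef2 _ _) (bcoef3 _ _) (bcoef4 _ _) => *.
ring.
Qed.

End TangentCurve.

(** * Attainment of the operator norm *)

Section Operators.
Variable R : realType.
Local Open Scope classical_set_scope.
Local Open Scope ring_scope.
Implicit Types (p q s t : R) (x y z u v w : 'cV[R]_2) (A B T : 'M[R]_2).

#[local] Opaque lpnorm.

Definition contraction p q T := forall z, lpnorm q (T *m z) <= lpnorm p z.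

Lemma matrix_ext A B : (forall z, A *m z = B *m z) -> A = B.
Proof.
move=> h; apply/matrixP => i j; have := h (delta_mx j 0).
by rewrite -!colE => /colP/(_ i); rewrite !mxE.
Qed.

(** A continuous ratio of norms has a maximum on the segment; the inequality is cross-multiplied. *)
Lemma norm_ratio_max p q T u w : 1 < p -> 1 < q ->
  (forall t, u + t *: w != 0) ->
  exists2 x, x != 0 & forall t, -1 <= t <= 1 ->
    lpnorm q (T *m (u + t *: w)) * lpnorm p x <= lpnorm q (T *m x) * lpnorm p (u + t *: w).
Proof.
move=> p1 q1 uw0; have p0 : 0 < p := lt_trans ltr01 p1.
pose f t := lpnorm q (T *m u + t *: (T *m w)) / lpnorm p (u + t *: w).
have n0 t : 0 < lpnorm p (u + t *: w) by rewrite lpnorm_gt0.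
have cf : continuous f.
  move=> t; apply: cvgM; first exact: lpnorm_line_continuous.
  by apply: cvgV; [rewrite gt_eqF|exact: lpnorm_line_continuous].
have le11 : -1 <= 1 :> R by lra.
have [c _ hc] := EVT_max le11 (continuous_subspaceT cf).
exists (u + c *: w); first exact: uw0.
move=> t t1.
have := hc t; rewrite in_itv /= t1 => /(_ isT).
rewrite !mulmxDr -!scalemxAr /f => h.
by rewrite -(ler_pdivlMr _ _ (n0 c)) mulrAC -(ler_pdivrMr _ _ (n0 t)).
Qed.

Lemma norm_attained p q T : 1 < p -> 1 < q ->
  exists2 x, lpnorm p x = 1 &
    forall z, lpnorm q (T *m z) <= lpnorm q (T *m x) * lpnorm p z.
Proof.
move=> p1 q1.
have p0 : 0 < p := lt_trans ltr01 p1; have q0 : 0 < q := lt_trans ltr01 q1.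
pose e0 : 'cV[R]_2 := delta_mx 0 0; pose e1 : 'cV[R]_2 := delta_mx 1 0.
have [a a0 ha] : exists2 x, x != 0 & forall t, -1 <= t <= 1 ->
    lpnorm q (T *m (e0 + t *: e1)) * lpnorm p x <= lpnorm q (T *m x) * lpnorm p (e0 + t *: e1).
  apply: norm_ratio_max => // t; apply/eqP => /matrixP /(_ 0 0); rewrite !mxE /=.
  by rewrite mulr0 addr0 => /eqP; rewrite oner_eq0.
have [b b0 hb] : exists2 x, x != 0 & forall t, -1 <= t <= 1 ->
    lpnorm q (T *m (e1 + t *: e0)) * lpnorm p x <= lpnorm q (T *m x) * lpnorm p (e1 + t *: e0).
  apply: norm_ratio_max => // t; apply/eqP => /matrixP /(_ 1 0); rewrite !mxE /=.
  by rewrite mulr0 addr0 => /eqP; rewrite oner_eq0.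
have pa : 0 < lpnorm p a by rewrite lpnorm_gt0.
have pb : 0 < lpnorm p b by rewrite lpnorm_gt0.
have all_z (M : R) : lpnorm q (T *m a) <= M * lpnorm p a ->
    lpnorm q (T *m b) <= M * lpnorm p b -> forall z, lpnorm q (T *m z) <= M * lpnorm p z.
  move=> Ma Mb z.
  have red k u x : x != 0 -> lpnorm q (T *m x) <= M * lpnorm p x ->
      lpnorm q (T *m u) * lpnorm p x <= lpnorm q (T *m x) * lpnorm p u ->
      lpnorm q (T *m (k *: u)) <= M * lpnorm p (k *: u).
    move=> x0 h1 h2; rewrite -scalemxAr (lpnormZ k (T *m u) q0) (lpnormZ k u p0).
      have px : 0 < lpnorm p x by rewrite lpnorm_gt0.
      rewrite [leRHS]mulrCA; apply: ler_wpM2l; first exact: normr_ge0.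
      rewrite -(ler_pM2r px); apply: le_trans h2 _.
      by rewrite [leRHS]mulrAC; apply: ler_wpM2r h1; apply: lpnorm_ge0.
  have abs1 (r m : R) : `|r| <= `|m| -> -1 <= r / m <= 1.
    rewrite -ler_norml normrM normfV; have [->|m0] := eqVneq m 0.
      by rewrite normr0 invr0 mulr0.
    by rewrite ler_pdivrMr ?normr_gt0 // mul1r.
  (* Dividing [z] by its larger coordinate puts it on one of the two segments; if that coordinate is
     0 then [z] is 0. *)
  have [z1|z1] := leP `|z 1 0| `|z 0 0|.
    have [z00|z00] := eqVneq (z 0 0) 0.
      have -> : z = 0 *: a.
        rewrite scale0r; apply: cV2P; rewrite mxE //.
        by move: z1; rewrite z00 normr0 normr_le0 => /eqP.
      exact: (red 0 a a a0 Ma (lexx _)).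
    have -> : z = z 0 0 *: (e0 + (z 1 0 / z 0 0) *: e1).
      apply: cV2P; rewrite !mxE /=; first by rewrite mulr0 addr0 mulr1.
      by rewrite add0r mulr1 mulrC divfK.
    exact: (red _ _ a a0 Ma (ha _ (abs1 _ _ z1))).
  have z10 : z 1 0 != 0 by rewrite -normr_gt0 (le_lt_trans _ z1).
  have -> : z = z 1 0 *: (e1 + (z 0 0 / z 1 0) *: e0).
    apply: cV2P; rewrite !mxE /=; last by rewrite mulr0 addr0 mulr1.
    by rewrite add0r mulr1 mulrC divfK.
  exact: (red _ _ b b0 Mb (hb _ (abs1 _ _ (ltW z1)))).
have fin x : x != 0 -> (forall z, lpnorm q (T *m z) <= (lpnorm q (T *m x) / lpnorm p x) * lpnorm p z) ->
    exists2 x, lpnorm p x = 1 & forall z, lpnorm q (T *m z) <= lpnorm q (T *m x) * lpnorm p z.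
  move=> x0 h; exists ((lpnorm p x)^-1 *: x); first exact: lpnorm_normalize.
  move=> z; rewrite -scalemxAr lpnormZ // ger0_norm ?invr_ge0 ?lpnorm_ge0 //.
  by rewrite [_^-1 * _]mulrC.
have [ab|ab] := leP (lpnorm q (T *m a) / lpnorm p a) (lpnorm q (T *m b) / lpnorm p b).
  apply: (fin b b0); apply: all_z; first by rewrite -(ler_pdivrMr _ _ pa).
  by rewrite (divfK (lt0r_neq0 pb)) lexx.
apply: (fin a a0); apply: all_z; first by rewrite (divfK (lt0r_neq0 pa)) lexx.
by rewrite -(ler_pdivrMr _ _ pb) (ltW ab).
Qed.

Lemma opnorm_max p q T x : 0 < p -> 0 < q -> lpnorm p x = 1 ->
  (forall z, lpnorm q (T *m z) <= lpnorm q (T *m x) * lpnorm p z) ->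
  opnorm p q T = lpnorm q (T *m x).
Proof.
move=> p0 q0 x1 h; rewrite /opnorm; set S := [set _ | _ in _].
have ub : ubound S (lpnorm q (T *m x)).
  move=> _ [z /= z1 <-]; apply: le_trans (h z) _.
  by rewrite -[leRHS]mulr1 ler_wpM2l ?lpnorm_ge0.
have Sx : S (lpnorm q (T *m x)) by exists x => //=; rewrite x1.
apply/eqP; rewrite eq_le ge_sup //=; last by exists (lpnorm q (T *m x)).
by apply: ub_le_sup => //; exists (lpnorm q (T *m x)).
Qed.

Lemma opnorm_le1 p q T : 1 < p -> 1 < q -> opnorm p q T <= 1 <-> contraction p q T.
Proof.
move=> p1 q1; have [x x1 h] := norm_attained T p1 q1.
rewrite (opnorm_max (lt_trans ltr01 p1) (lt_trans ltr01 q1) x1 h); split=> [le1 z|].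
  by apply: le_trans (h z) _; rewrite -[leRHS]mul1r ler_wpM2r ?lpnorm_ge0.
by move=> /(_ x); rewrite x1.
Qed.

Lemma opnorm_eq1 p q T : 1 < p -> 1 < q -> opnorm p q T = 1 ->
  contraction p q T /\ exists2 x, lpnorm p x = 1 & lpnorm q (T *m x) = 1.
Proof.
move=> p1 q1 e; split; first by apply/opnorm_le1; rewrite // e.
have [x x1 h] := norm_attained T p1 q1; exists x; first exact: x1.
by rewrite -(opnorm_max (lt_trans ltr01 p1) (lt_trans ltr01 q1) x1 h).
Qed.

End Operators.

(** * The one-parameter family through [x] and [y], and criteria for extremality *)

Section Extremality.
Variable R : realType.
Local Open Scope classical_set_scope.
Local Open Scope ring_scope.
Implicit Types (p q s t : R) (x y z u v w : 'cV[R]_2) (A B T : 'M[R]_2).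

#[local] Opaque lpnorm.

Lemma convex_comb_max t (a b c : R) : 0 < t < 1 -> a <= c -> b <= c ->
  t * a + (1 - t) * b = c -> a = c /\ b = c.
Proof.
move=> /andP[t0]; rewrite -subr_gt0 => t1 ac bc e.
have h1 : 0 <= t * (c - a) by rewrite mulr_ge0 ?subr_ge0 // ltW.
have h2 : 0 <= (1 - t) * (c - b) by rewrite mulr_ge0 ?(ltW t1) ?subr_ge0.
have h3 : t * (c - a) + (1 - t) * (c - b) = 0.
  by transitivity (c - (t * a + (1 - t) * b)); [ring|rewrite e subrr].
move/eqP: h3; rewrite paddr_eq0 // !mulf_eq0 (gt_eqF t0) (gt_eqF t1) /= !subr_eq0.
by move=> /andP[/eqP -> /eqP ->].
Qed.

Lemma rank_one_mul (a b z : 'cV[R]_2) : rank_one a b *m z = dot a z *: b.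
Proof. exact: rank_oneE. Qed.

Lemma dot_mulmx A u z : dot u (A *m z) = dot (A^T *m u) z.
Proof.
rewrite /dot !mxE !big_ord_recl !big_ord0 !mxE.
have -> : lift ord0 ord0 = 1 :> 'I_2 by apply/val_inj.
have -> : ord0 = 0 :> 'I_2 by [].
move: (A _ _) (A _ _) (A _ _) (A _ _) (u _ _) (u _ _) (z _ _) (z _ _) => *.
ring.
Qed.

(* The operators taking the unit vector [x] to the unit vector [y] whose adjoint
   takes the support functional of [y] to that of [x]. *)
Definition opfam p q x y s :=
  rank_one (spow (p - 1) x) y + s *: rank_one (perp x) (tangent q y).

Lemma opfamE p q x y s z : opfam p q x y s *m z =
  dot (spow (p - 1) x) z *: y + (s * dot (perp x) z) *: tangent q y.
Proof. by rewrite mulmxDl -scalemxAl !rank_one_mul scalerA. Qed.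

Lemma tangent_decomposition p x z : 0 < p -> lpnorm p x = 1 ->
  z = dot (spow (p - 1) x) z *: x + dot (perp x) z *: tangent p x.
Proof.
move=> p0 x1; have e : dot (spow (p - 1) x) x = 1.
  by rewrite dot_spow //; apply/lpnorm_eq1.
move: e; rewrite /tangent; move: (spow _ _) => f e.
(* This identity holds for every vector [f]; the normalisation only makes the factor of [z] equal to
   1. *)
suff h : dot f x *: z = dot f z *: x + dot (perp x) z *: perp f.
  by rewrite -h e scale1r.
apply: cV2P; rewrite !mxE /= /dot !perpE;
move: (f 0 0) (f 1 0) (x 0 0) (x 1 0) (z 0 0) (z 1 0) => *; ring.
Qed.

Lemma dot_tangent p x : dot (spow (p - 1) x) (tangent p x) = 0.
Proof. exact: dot_perp. Qed.

Lemma dot_perp_tangent p x : 0 < p -> lpnorm p x = 1 -> dot (perp x) (tangent p x) = 1.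
Proof.
by move=> p0 x1; rewrite dot_perp2 dotC dot_spow //; apply/lpnorm_eq1.
Qed.

Lemma dot_spow_unit p x : 0 < p -> lpnorm p x = 1 -> dot (spow (p - 1) x) x = 1.
Proof. by move=> p0 x1; rewrite dot_spow //; apply/lpnorm_eq1. Qed.

Lemma opfam_line p q x y s a b : 0 < p -> lpnorm p x = 1 ->
  opfam p q x y s *m (a *: x + b *: tangent p x) = a *: y + (s * b) *: tangent q y.
Proof.
move=> p0 x1; rewrite opfamE !dotDr !dotZr dot_tangent dot_spow_unit //.
rewrite dot_perp_tangent // [dot (perp x) x]dotC dot_perp.
by rewrite !mulr1 !mulr0 addr0 add0r.
Qed.

Lemma opfam_unit p q x y s : 0 < p -> lpnorm p x = 1 -> opfam p q x y s *m x = y.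
Proof.
move=> p0 x1; rewrite opfamE dot_spow_unit // [dot (perp x) x]dotC dot_perp.
by rewrite mulr0 scale0r addr0 scale1r.
Qed.

Lemma opfam_contractionP p q x y s : 0 < p -> lpnorm p x = 1 ->
  contraction p q (opfam p q x y s) <->
  forall a b, lpnorm q (a *: y + (s * b) *: tangent q y) <= lpnorm p (a *: x + b *: tangent p x).
Proof.
move=> p0 x1; split=> h.
  by move=> a b; rewrite -(opfam_line q y s a b p0 x1); apply: h.
move=> z; rewrite (tangent_decomposition z p0 x1).
by rewrite opfam_line //; apply: h.
Qed.

(** The adjoint sends the support functional of [y] to a functional bounded by the norm and equal to
    1 at [x], which by smoothness is that of [x]. Hence [T] maps the tangent at [x] to a multiple
    [s] of the tangent at [y]. *)
Lemma contraction_opfam p q T x y : 1 < p -> 1 < q ->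
  lpnorm p x = 1 -> lpnorm q y = 1 -> contraction p q T -> T *m x = y ->
  exists s, T = opfam p q x y s.
Proof.
move=> p1 q1 x1 y1 hT Txy.
have p0 : 0 < p := lt_trans ltr01 p1; have q0 : 0 < q := lt_trans ltr01 q1.
have ephi : T^T *m spow (q - 1) y = spow (p - 1) x.
  apply: (support_functional_unique p1) => //.
    by move=> z; rewrite -dot_mulmx; apply: le_trans (hoelder_dot _ q1 y1) (hT z).
  by rewrite -dot_mulmx Txy dot_spow_unit.
exists (dot (perp y) (T *m tangent p x)); apply: matrix_ext => z.
rewrite opfamE {1}(tangent_decomposition z p0 x1) mulmxDr -!scalemxAr Txy.
congr (_ + _); rewrite {1}(tangent_decomposition (T *m tangent p x) q0 y1).
rewrite dot_mulmx ephi dot_tangent scale0r add0r scalerA mulrC //.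
Qed.

Lemma opfam_inj p q x y s s' : 0 < p -> 0 < q -> lpnorm p x = 1 -> lpnorm q y = 1 ->
  opfam p q x y s = opfam p q x y s' -> s = s'.
Proof.
move=> p0 q0 x1 y1 /(congr1 (fun M => dot (perp y) (M *m (0 *: x + 1 *: tangent p x)))).
by rewrite !opfam_line // !dotDr !dotZr dot_perp_tangent // !mulr1 => /addrI.
Qed.

Lemma opfam_convex p q x y s s' t :
  t *: opfam p q x y s + (1 - t) *: opfam p q x y s' = opfam p q x y (t * s + (1 - t) * s').
Proof.
rewrite /opfam !scalerDr !scalerA addrACA -!scalerDl.
by rewrite [t + (1 - t)]addrC subrK scale1r.
Qed.

(** The support functional of [T *m x] is at most 1 on both images and averages to 1, so it equals 1
    on both; the equality case of Hoelder identifies them. *)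
Lemma convex_attained p q T A B x t : 1 < p -> 1 < q ->
  contraction p q A -> contraction p q B -> 0 < t < 1 ->
  T = t *: A + (1 - t) *: B -> lpnorm p x = 1 -> lpnorm q (T *m x) = 1 ->
  A *m x = T *m x /\ B *m x = T *m x.
Proof.
move=> p1 q1 hA hB /andP[t0 t1] eT x1 y1.
have q0 : 0 < q := lt_trans ltr01 q1.
pose f := dot (spow (q - 1) (T *m x)).
have Ax : lpnorm q (A *m x) <= 1 by rewrite -x1 hA.
have Bx : lpnorm q (B *m x) <= 1 by rewrite -x1 hB.
have fA : f (A *m x) <= 1 by apply: le_trans (hoelder_dot _ q1 y1) Ax.
have fB : f (B *m x) <= 1 by apply: le_trans (hoelder_dot _ q1 y1) Bx.
have fT : t * f (A *m x) + (1 - t) * f (B *m x) = 1.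
  rewrite -[RHS](dot_spow_unit q0 y1) {2}eT mulmxDl -!scalemxAl.
  by rewrite dotDr !dotZr.
have [eA eB] := convex_comb_max (introT andP (conj t0 t1)) fA fB fT.
by split; apply: (hoelder_dot_eq q1 y1).
Qed.

(** If [T] is an average of contractions, these lie in the same family with parameters in
    [[-|s|, |s|]] averaging to the endpoint [s], so both parameters are [s]. *)
Lemma extreme_of_endpoint p q x y s : 1 < p -> 1 < q ->
  lpnorm p x = 1 -> lpnorm q y = 1 -> contraction p q (opfam p q x y s) ->
  (forall s', contraction p q (opfam p q x y s') -> `|s'| <= `|s|) ->
  extreme_contraction p q (opfam p q x y s).
Proof.
move=> p1 q1 x1 y1 hT hs.
have p0 : 0 < p := lt_trans ltr01 p1; have q0 : 0 < q := lt_trans ltr01 q1.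
split; first exact/opnorm_le1.
move=> A B t /= /(opnorm_le1 _ p1 q1) hA /(opnorm_le1 _ p1 q1) hB t01 eT.
have Tx := opfam_unit q y s p0 x1.
have [] := convex_attained p1 q1 hA hB t01 eT x1 _; first by rewrite Tx.
rewrite Tx => Ax Bx.
have [a ea] := contraction_opfam p1 q1 x1 y1 hA Ax.
have [b eb] := contraction_opfam p1 q1 x1 y1 hB Bx.
have ha := hs a; rewrite -ea in ha; have {}ha := ha hA.
have hb := hs b; rewrite -eb in hb; have {}hb := hb hB.
move: eT; rewrite ea eb opfam_convex => /(opfam_inj p0 q0 x1 y1) es.
suff [-> ->] : a = s /\ b = s by [].
have [s0|s0] := leP 0 s.
  rewrite (ger0_norm s0) in ha hb.
  exact: (convex_comb_max t01 (le_trans (ler_norm _) ha) (le_trans (ler_norm _) hb) (esym es)).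
move: ha hb; rewrite (ltr0_norm s0) => /ler_normlP[ha _] /ler_normlP[hb _].
have es' : t * - a + (1 - t) * - b = - s by rewrite !mulrN -opprD -es.
have [ea' eb'] := convex_comb_max t01 ha hb es'.
by split; apply: oppr_inj.
Qed.

Lemma extreme_no_room p q x y s e : 1 < p -> 1 < q -> 
  lpnorm p x = 1 -> lpnorm q y = 1 -> 0 < e ->
  extreme_contraction p q (opfam p q x y s) ->
  contraction p q (opfam p q x y (s + e)) -> contraction p q (opfam p q x y (s - e)) ->
  False.
Proof.
move=> p1 q1 x1 y1 e0 [_ hT] hp hm.
have p0 : 0 < p := lt_trans ltr01 p1; have q0 : 0 < q := lt_trans ltr01 q1.
have [||||eq _] := hT (opfam p q x y (s + e)) (opfam p q x y (s - e)) 2^-1.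
- by apply/(opnorm_le1 _ p1 q1); exact: hp.
- by apply/(opnorm_le1 _ p1 q1); exact: hm.
- by rewrite invr_gt0 ltr0n invf_lt1 ?ltr0n // ltr1n.
- by rewrite opfam_convex; congr opfam; field.
have ee := opfam_inj p0 q0 x1 y1 eq.
by move: e0; clear -ee; lra.
Qed.

(** [dot (perp u) v] is the determinant of the columns [u] and [v]. *)
Lemma free_pairP u v : free [:: u; v] <-> dot (perp u) v != 0.
Proof.
have dE : dot (perp u) v = u 0 0 * v 1 0 - u 1 0 * v 0 0 by rewrite /dot !perpE; ring.
rewrite dE free_cons seq1_free span_seq1; split=> [/andP[uv v0]|h].
  apply: contra uv => /eqP /subr0_eq e; apply/vlineP.
  have [v00|v00] := eqVneq (v 0 0) 0.
    have v10 : v 1 0 != 0.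
      by apply: contra v0 => /eqP v10; apply/eqP/cV2P; rewrite mxE.
    exists (u 1 0 / v 1 0); apply: cV2P; rewrite mxE ?divfK //.
    by apply: (mulIf v10); rewrite e v00 !mulr0 mul0r.
  exists (u 0 0 / v 0 0); apply: cV2P; rewrite mxE ?divfK //.
  by rewrite mulrAC e mulfK.
apply/andP; split; last first.
  by apply: contra h => /eqP ->; rewrite !mxE !mulr0 subrr.
apply: contra h => /vlineP[k ->]; rewrite !mxE; apply/eqP.
by move: (v 0 0) (v 1 0) => *; ring.
Qed.

Lemma agree_on_pair A B u v : dot (perp u) v != 0 ->
  A *m u = B *m u -> A *m v = B *m v -> A = B.
Proof.
move=> d0 eu ev; apply: matrix_ext => z.
(* Cramer's rule in the basis [u], [v]. *)
have -> : z = (dot (perp u) v)^-1 *: (- dot (perp v) z *: u + dot (perp u) z *: v).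
  have e : dot (perp u) v *: z = - dot (perp v) z *: u + dot (perp u) z *: v.
    apply: cV2P; rewrite !mxE /dot !perpE;
    move: (u 0 0) (u 1 0) (v 0 0) (v 1 0) (z 0 0) (z 1 0) => *; ring.
  by rewrite -e scalerA mulVf // scale1r.
by rewrite -!scalemxAr !mulmxDr -!scalemxAr eu ev.
Qed.

(** Two contractions averaging to [T] agree with it wherever it attains its norm, here on a
    basis. *)
Lemma extreme_of_two p q T : 1 < p -> 1 < q -> opnorm p q T = 1 ->
  attains_norm_on_two_independent p q T -> extreme_contraction p q T.
Proof.
move=> p1 q1 T1 [u [v [/free_pairP uv [u0 hu] [v0 hv]]]].
have p0 : 0 < p := lt_trans ltr01 p1; have q0 : 0 < q := lt_trans ltr01 q1.
split; first by rewrite /= T1.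
move=> A B t /= /(opnorm_le1 _ p1 q1) hA /(opnorm_le1 _ p1 q1) hB t01 eT.
have key w : w != 0 -> lpnorm q (T *m w) = opnorm p q T * lpnorm p w ->
    A *m w = T *m w /\ B *m w = T *m w.
  rewrite T1 mul1r => w0 hw.
  have pw : 0 < lpnorm p w by rewrite lpnorm_gt0.
  have ipw : 0 < (lpnorm p w)^-1 by rewrite invr_gt0.
  have w1 := lpnorm_normalize p0 w0.
  have [] := convex_attained p1 q1 hA hB t01 eT w1 _.
    rewrite -scalemxAr (lpnormZ _ (T *m w) q0) hw (gtr0_norm ipw).
    exact: mulVf (lt0r_neq0 pw).
  have i0 := lt0r_neq0 ipw.
  by rewrite -!(scalemxAr _ _ w) => eA eB; split; apply: (scalerI i0); [exact: eA|exact: eB].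
have [Au Bu] := key u u0 hu; have [Av Bv] := key v v0 hv.
by split; apply: (agree_on_pair uv).
Qed.

End Extremality.

(** * Perturbation of the parameter and the resulting alternatives *)

Section Dichotomy.
Variable R : realType.
Local Open Scope classical_set_scope.
Local Open Scope ring_scope.
Implicit Types (p q s t : R) (x y z u v w : 'cV[R]_2) (A B T : 'M[R]_2).

#[local] Opaque lpnorm.

Lemma contraction_curve p q x y s t : 0 < p -> lpnorm p x = 1 ->
  contraction p q (opfam p q x y s) -> curve q y (s * t) <= curve p x t.
Proof.
move=> p0 x1 /(opfam_contractionP _ _ _ p0 x1) /(_ 1 t).
by rewrite !scale1r.
Qed.

(** Directions near that of [x] are covered by the assumed local comparison. The others, scaled to
    [b = 1], form a compact segment on which the strict inequality has a positive minimal gap, and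
    this gap absorbs a small change of [s]. *)
Lemma slack_extends p q x y s d e : 1 < p -> 1 < q ->
  lpnorm p x = 1 -> lpnorm q y = 1 ->
  (forall a b, b != 0 ->
     lpnorm q (a *: y + (s * b) *: tangent q y) < lpnorm p (a *: x + b *: tangent p x)) ->
  0 < d -> 0 < e ->
  (forall s' t, `|s' - s| <= e -> `|t| <= d -> curve q y (s' * t) <= curve p x t) ->
  exists2 e' : R, 0 < e' &
    forall s', `|s' - s| <= e' -> contraction p q (opfam p q x y s').
Proof.
move=> p1 q1 x1 y1 strict d0 e0 slack.
have p0 : 0 < p := lt_trans ltr01 p1; have q0 : 0 < q := lt_trans ltr01 q1.
set w := tangent q y in strict *; set v := tangent p x in strict *.
pose h a := lpnorm p (v + a *: x) - lpnorm q (s *: w + a *: y).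
have h_gt0 a : 0 < h a.
  by rewrite subr_gt0 [v + _]addrC [s *: w + _]addrC; have := strict a 1 (oner_neq0 _); rewrite mulr1 scale1r.
have ch : continuous h.
  by move=> a; apply: cvgB; apply: lpnorm_line_continuous.
have dd : - d^-1 <= d^-1 by rewrite (@le_trans _ _ 0) ?oppr_le0 ?invr_ge0 ?(ltW d0).
have [c _ hc] := EVT_min dd (continuous_subspaceT ch).
have K0 : 0 < lpnorm q w + 1 by rewrite ltr_wpDl ?lpnorm_ge0.
have e'0 : 0 < h c / (lpnorm q w + 1) by rewrite divr_gt0.
exists (Num.min e (h c / (lpnorm q w + 1))); first by rewrite lt_min e0 e'0.
move=> s'; rewrite le_min (ler_pdivlMr _ _ K0) => /andP[se sh].
apply/(opfam_contractionP _ _ _ p0 x1) => a b; rewrite -/w -/v.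
have [->|b0] := eqVneq b 0.
  by rewrite mulr0 !scale0r !addr0 (lpnormZ _ y q0) (lpnormZ _ x p0) x1 y1 lexx.
have [ad|ad] := leP `|a / b| d^-1.
  have -> : a *: y + (s' * b) *: w = b *: (s' *: w + (a / b) *: y).
    by rewrite scalerDr !scalerA addrC [b * s']mulrC [b * (a / b)]mulrC divfK.
  have -> : a *: x + b *: v = b *: (v + (a / b) *: x).
    by rewrite scalerDr !scalerA addrC [b * (a / b)]mulrC divfK.
  rewrite (lpnormZ _ _ q0) (lpnormZ _ _ p0); apply: ler_wpM2l; first exact: normr_ge0.
  have -> : s' *: w + (a / b) *: y = (s *: w + (a / b) *: y) + (s' - s) *: w.
    by rewrite addrAC -scalerDl addrC [s + _]addrC subrK addrC.
  apply: le_trans (ler_lpnormD _ _ q1) _; rewrite (lpnormZ _ w q0) -lerBrDl.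
  have := hc (a / b); rewrite in_itv /= -ler_norml => /(_ ad).
  apply: le_trans; apply: le_trans sh.
  by apply: ler_wpM2l; [exact: normr_ge0|rewrite lerDl].
have a0 : a != 0.
  apply: contraTneq ad => ->; rewrite mul0r normr0 -leNgt invr_ge0; exact: ltW.
have -> : a *: y + (s' * b) *: w = a *: (y + (s' * (b / a)) *: w).
  by rewrite scalerDr scalerA mulrCA [a * (b / a)]mulrC divfK.
have -> : a *: x + b *: v = a *: (x + (b / a) *: v).
  by rewrite scalerDr scalerA [a * (b / a)]mulrC divfK.
rewrite (lpnormZ _ _ q0) (lpnormZ _ _ p0); apply: ler_wpM2l; first exact: normr_ge0.
(* The remaining condition [|b / a| <= d] is the inverse of [d^-1 < |a / b|]. *)
apply: slack se _; rewrite -[b / a]invrK invf_div normfV -[leRHS]invrK.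
by rewrite lef_pV2 ?posrE ?invr_gt0 // ?ltW // normr_gt0 mulf_neq0 ?invr_neq0.
Qed.

(** Equality at a vector off the line of [x] would provide a second independent vector of norm
    attainment. *)
Lemma strict_of_not_two p q x y s : 1 < p -> 1 < q ->
  lpnorm p x = 1 -> lpnorm q y = 1 -> opnorm p q (opfam p q x y s) = 1 ->
  ~ attains_norm_on_two_independent p q (opfam p q x y s) ->
  forall a b, b != 0 ->
    lpnorm q (a *: y + (s * b) *: tangent q y) < lpnorm p (a *: x + b *: tangent p x).
Proof.
move=> p1 q1 x1 y1 T1 not2 a b b0.
have p0 : 0 < p := lt_trans ltr01 p1; have q0 : 0 < q := lt_trans ltr01 q1.
have [hT _] := opnorm_eq1 p1 q1 T1.
rewrite lt_neqAle ((opfam_contractionP _ _ _ p0 x1).1 hT) andbT.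
apply/eqP => e; apply: not2.
set z := a *: x + b *: tangent p x in e.
have dz : dot (perp x) z = b.
  rewrite /z dotDr 2!dotZr (dot_perp_tangent p0 x1) [dot (perp x) x]dotC dot_perp.
  by rewrite mulr0 add0r mulr1.
have x0 : x != 0 by rewrite -(lpnorm_gt0 x p0) x1 ltr01.
have z0 : z != 0.
  by apply: contraNneq b0 => z0; rewrite -dz z0 /dot !mxE !mulr0 addr0.
exists x, z; split.
- by apply/free_pairP; rewrite dz.
- by split; [exact: x0|rewrite (opfam_unit _ _ _ p0 x1) T1 x1 y1 mul1r].
split; first exact: z0.
by rewrite T1 mul1r /z (opfam_line q y s a b p0 x1); exact: e.
Qed.

Lemma extreme_dichotomy p q x y s : 1 < p -> 1 < q ->
  lpnorm p x = 1 -> lpnorm q y = 1 -> opnorm p q (opfam p q x y s) = 1 ->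
  ~ attains_norm_on_two_independent p q (opfam p q x y s) ->
  extreme_contraction p q (opfam p q x y s) ->
  (curve_order q y < curve_order p x /\ s = 0) \/
  (curve_order q y = curve_order p x /\
     curve_coef q y * `|s| `^ curve_order p x = curve_coef p x).
Proof.
move=> p1 q1 x1 y1 T1 not2 ext.
have p0 : 0 < p := lt_trans ltr01 p1; have q0 : 0 < q := lt_trans ltr01 q1.
have strict := strict_of_not_two p1 q1 x1 y1 T1 not2.
have [hT _] := opnorm_eq1 p1 q1 T1.
have hc t := contraction_curve t p0 x1 hT.
have lf := curve_leading p1 x1; have lg := curve_leading q1 y1.
have m0 := curve_order_gt0 x p1; have n0 := curve_order_gt0 y q1.
have c0 := curve_coef_gt0 p1 x1; have c'0 := curve_coef_gt0 q1 y1.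
(* Slack near [x] would make the operators with parameters [s + e'] and [s - e'] contractions, and
   [T] is their midpoint. *)
have no_slack : ~ exists d e : R, [/\ 0 < d, 0 < e &
    forall s' t, `|s' - s| <= e -> `|t| <= d -> curve q y (s' * t) <= curve p x t].
  move=> [d [e [d0 e0 slack]]].
  have [e' e'0 h] := slack_extends p1 q1 x1 y1 strict d0 e0 slack.
  apply: (extreme_no_room p1 q1 x1 y1 e'0 ext); apply: h.
    by rewrite addrC addKr (gtr0_norm e'0).
  by rewrite addrC addKr normrN (gtr0_norm e'0).
have [nm|mn|nm] := ltgtP (curve_order q y) (curve_order p x).
- by left; split=> //; apply: (leading_lt_eq0 lf lg m0 c0 c'0 nm hc).
- by case: no_slack; apply: (leading_slack_gt lf lg m0 n0 c0 c'0 s mn).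
right; split=> //; have := leading_eq_le lf lg nm hc.
rewrite le_eqVlt => /orP[/eqP //|lt].
by case: no_slack; apply: (leading_slack_eq lf lg m0 c0 c'0 nm lt).
Qed.

(** Here [l] is [s] in the parameters [t / (x_1 x_2)] and [t / (y_1 y_2)] in which the two curves
    become [bmean]. *)
Lemma critical_nondeg p q x y s : 1 < p -> 1 < q ->
  lpnorm p x = 1 -> lpnorm q y = 1 -> nondeg x -> nondeg y ->
  contraction p q (opfam p q x y s) ->
  curve_coef q y * `|s| `^ 2 = curve_coef p x ->
  let l := s * (x 0 0 * x 1 0) / (y 0 0 * y 1 0) in
  (forall t, bmean q (`|y 0 0| `^ q) (l * t) `^ q^-1 <= bmean p (`|x 0 0| `^ p) t `^ p^-1) /\
  l ^+ 2 * bcoef2 q (`|y 0 0| `^ q) = bcoef2 p (`|x 0 0| `^ p).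
Proof.
move=> p1 q1 x1 y1 nx ny hT crit l.
have p0 : 0 < p := lt_trans ltr01 p1; have q0 : 0 < q := lt_trans ltr01 q1.
split=> [t|].
  have := contraction_curve (t * (x 0 0 * x 1 0)) p0 x1 hT.
  rewrite (curve_nondeg _ p1 x1 nx) (curve_nondeg _ q1 y1 ny) (mulfK nx).
  by have -> : s * (t * (x 0 0 * x 1 0)) / (y 0 0 * y 1 0) = l * t by rewrite mulrCA -mulrA mulrC.
move: crit; rewrite /curve_coef nx ny.
have -> : `|s| `^ 2 = s ^+ 2.
  by rewrite -[2]/(2%:R) powR_mulrn // real_normK ?num_real.
move=> /(congr1 (fun r => r * (x 0 0 * x 1 0) ^+ 2)).
rewrite divfK ?expf_neq0 // => <-; rewrite /l exprMn exprMn exprVn.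
by move: (bcoef2 _ _) ((_ * _) ^+ 2) (s ^+ 2) ((_ * _) ^+ 2)^-1 => *; ring.
Qed.

End Dichotomy.

(** * Euclidean, coordinate and diagonal unit vectors *)

Section SpecialVectors.
Variable R : realType.
Implicit Types (k p q s t : R) (x y z : 'cV[R]_2).

Lemma spow1 x : spow (2 - 1) x = x.
Proof.
have -> : 2 - 1 = 1 :> R by ring.
by apply: cV2P; rewrite spowE sgpow1.
Qed.

Lemma curve_order2 x : curve_order 2 x = 2.
Proof. by rewrite /curve_order; case: ifP. Qed.

Lemma psum2 x : psum 2 x = x 0 0 ^+ 2 + x 1 0 ^+ 2.
Proof.
by rewrite /psum -[2]/(2%:R) !powR_mulrn ?normr_ge0 // !real_normK ?num_real.
Qed.

Lemma lpnorm2_line x a b : lpnorm 2 x = 1 ->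
  lpnorm 2 (a *: x + b *: tangent 2 x) = (a ^+ 2 + b ^+ 2) `^ 2^-1.
Proof.
move=> x1; have {x1} := (lpnorm_eq1 x (ltr0Sn _ 1)).1 x1; rewrite psum2 => x1.
rewrite /lpnorm -/(psum 2 _) psum2 /tangent spow1; congr (_ `^ _).
rewrite !mxE /=; move: (x 0 0) (x 1 0) x1 => u v uv.
transitivity ((a ^+ 2 + b ^+ 2) * (u ^+ 2 + v ^+ 2)); first by ring.
by rewrite uv mulr1.
Qed.

(** In the Euclidean case the nondegenerate formula gives the same value as the degenerate one. *)
Lemma curve_coef2 x : lpnorm 2 x = 1 -> curve_coef 2 x = 2^-1.
Proof.
move=> x1; rewrite /curve_coef; case: ifP => // nx.
have {x1} := (lpnorm_eq1 x (ltr0Sn _ 1)).1 x1; rewrite psum2 => x1.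
rewrite /bcoef2 -[X in _ `^ X]/(2%:R) powR_mulrn // real_normK ?num_real //.
have -> : 1 - x 0 0 ^+ 2 = x 1 0 ^+ 2 by rewrite -x1; ring.
move: nx; rewrite /nondeg mulf_eq0 negb_or.
by move: (x 0 0) (x 1 0) => u v /andP[u0 v0]; field; rewrite u0 v0.
Qed.

Lemma diagonal_unit p : 0 < p -> exists x : 'cV[R]_2, lpnorm p x = 1 /\ nondeg x.
Proof.
move=> p0; have h0 : 0 < 2^-1 `^ p^-1 :> R by rewrite powR_gt0 ?invr_gt0 ?ltr0n.
exists (const_mx (2^-1 `^ p^-1)); split; last first.
  by rewrite /nondeg !mxE mulf_neq0 // gt_eqF.
apply/lpnorm_eq1 => //; rewrite /psum !mxE (gtr0_norm h0) -powRrM mulVf ?gt_eqF //.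
by rewrite powRr1 ?invr_ge0 ?ler0n //; field.
Qed.

Lemma lpnorm_unitZ p k x : 0 < p -> `|k| = 1 -> lpnorm p (k *: x) = lpnorm p x.
Proof. by move=> p0 k1; rewrite lpnormZ // k1 mul1r. Qed.

Lemma spow_unitZ (r k : R) x : `|k| = 1 -> spow r (k *: x) = k *: spow r x.
Proof.
move=> k1; apply: cV2P; rewrite !mxE sgrM normrM k1 mul1r -mulrA;
by congr (_ * _); rewrite [RHS]numEsg k1 mulr1.
Qed.

Lemma sgpow_one (r : R) : sgpow r 1 = 1.
Proof. by rewrite sgpow_gt0 ?ltr01 // powR1. Qed.

Lemma evecE (i : 'I_2) : (evec i : 'cV[R]_2) = \col_j (j == i)%:R.
Proof. by apply/matrixP => j l; rewrite !mxE (ord1 l) eqxx andbT. Qed.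

Lemma spow_evec (r : R) (i : 'I_2) : spow r (evec i) = evec i.
Proof.
apply/matrixP => j l; rewrite evecE !mxE -/(sgpow _ _).
by case: (j == i); rewrite ?sgpow_one ?sgpow0.
Qed.

Lemma lpnorm_evec p (i : 'I_2) : 0 < p -> lpnorm p (evec i : 'cV[R]_2) = 1.
Proof.
move=> p0; apply/lpnorm_eq1 => //; rewrite /psum evecE !mxE.
have pow0 : 0 `^ p = 0 :> R by rewrite powR0 // gt_eqF.
by case: i => [[|[|//]]] ? /=; rewrite normr0 normr1 pow0 powR1 ?addr0 ?add0r.
Qed.

Lemma nondeg_evec (i : 'I_2) : nondeg (evec i : 'cV[R]_2) = false.
Proof.
rewrite /nondeg evecE !mxE.
by case: i => [[|[|//]]] ? /=; rewrite ?mulr0 ?mul0r eqxx.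
Qed.

Lemma deg_unitP p x : 0 < p -> lpnorm p x = 1 -> ~~ nondeg x ->
  exists (i : 'I_2) k, `|k| = 1 /\ x = k *: evec i.
Proof.
move=> p0 x1; rewrite /nondeg negbK mulf_eq0 => nx.
have [i [k xE]] : exists (i : 'I_2) k, x = k *: evec i.
  case/orP: nx => /eqP e.
    by exists 1, (x 1 0); apply: cV2P; rewrite !mxE /= ?mulr0 ?mulr1.
  by exists 0, (x 0 0); apply: cV2P; rewrite !mxE /= ?mulr0 ?mulr1.
exists i, k; split=> //.
by rewrite -x1 xE lpnormZ // lpnorm_evec // mulr1.
Qed.

Lemma rank_oneZ k (a b : 'cV[R]_2) : rank_one (k *: a) b = rank_one a (k *: b).
Proof. by rewrite /rank_one linearZ /= -scalemxAr -scalemxAl. Qed.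

(** Both coordinates have modulus [h = 2^(-1/p)], and [2 h^2] is the power [2^((p-2)/p)] in the
    statement of the theorem. *)
Lemma half_coef p x : 1 < p -> `|x 0 0| `^ p = 1 / 2 -> `|x 1 0| `^ p = 1 / 2 ->
  [/\ lpnorm p x = 1, nondeg x &
      curve_coef p x = (p - 1) / 2 / (2 `^ ((p - 2) / p)) ^+ 2].
Proof.
move=> p1 e0 e1; have p0 : 0 < p := lt_trans ltr01 p1.
pose h : R := 2 `^ (- p^-1).
have h0 : 0 < h by rewrite powR_gt0 ?ltr0n.
have hp (a : R) : `|a| `^ p = 1 / 2 -> `|a| = h.
  move=> e; apply: (powR_injective p0); rewrite ?nnegrE ?normr_ge0 ?(ltW h0) //.
  by rewrite e /h -powRrM mulNr mulVf ?gt_eqF // powR_inv1 ?ler0n // div1r.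
have x0 := hp _ e0; have x1 := hp _ e1.
have nx : nondeg x.
  by rewrite /nondeg mulf_neq0 // -normr_gt0 ?x0 ?x1.
split=> //; first by apply/lpnorm_eq1; rewrite // /psum e0 e1; field.
rewrite /curve_coef nx e0 /bcoef2.
have -> : (x 0 0 * x 1 0) ^+ 2 = h ^+ 4.
  rewrite -[LHS]real_normK ?num_real // normrM x0 x1; ring.
have -> : 2 `^ ((p - 2) / p) = 2 * h ^+ 2 :> R.
  have -> : (p - 2) / p = 1 + (- p^-1 + - p^-1) by field; rewrite gt_eqF.
  have z2 : (2 != 0 :> R) by rewrite pnatr_eq0.
  rewrite powRD ?z2 ?implybT // powRr1 ?ler0n //.
  by rewrite powRD ?z2 ?implybT // expr2.
by field; rewrite gt_eqF.
Qed.

End SpecialVectors.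

(** * Sufficient conditions for extremality; consequences of criticality *)

Section Endpoints.
Variable R : realType.
Implicit Types (k p q s t : R) (x y z : 'cV[R]_2).

#[local] Opaque lpnorm.

Lemma opfam0 p q x y : opfam p q x y 0 = rank_one (spow (p - 1) x) y.
Proof. by rewrite /opfam scale0r addr0. Qed.

(** When the order at [y] is smaller, every contraction of the family has parameter 0. *)
Lemma extreme_rank_one p q x y : 1 < p -> 1 < q ->
  lpnorm p x = 1 -> lpnorm q y = 1 -> curve_order q y < curve_order p x ->
  opnorm p q (opfam p q x y 0) = 1 -> extreme_contraction p q (opfam p q x y 0).
Proof.
move=> p1 q1 x1 y1 lt T1.
have [hT _] := opnorm_eq1 p1 q1 T1.
apply: (extreme_of_endpoint p1 q1 x1 y1 hT) => s' hs'.
rewrite (_ : s' = 0) //.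
apply: (leading_lt_eq0 (curve_leading p1 x1) (curve_leading q1 y1)
  (curve_order_gt0 x p1) (curve_coef_gt0 p1 x1) (curve_coef_gt0 q1 y1) lt) => t.
exact: contraction_curve (lt_trans ltr01 p1) x1 hs'.
Qed.

(** At equal orders a contraction satisfies [c' |s'|^m <= c], and the critical [s] attains this
    bound. *)
Lemma extreme_critical p q x y s : 1 < p -> 1 < q ->
  lpnorm p x = 1 -> lpnorm q y = 1 -> curve_order q y = curve_order p x ->
  curve_coef q y * `|s| `^ curve_order p x = curve_coef p x ->
  opnorm p q (opfam p q x y s) = 1 -> extreme_contraction p q (opfam p q x y s).
Proof.
move=> p1 q1 x1 y1 eo ec T1.
have [hT _] := opnorm_eq1 p1 q1 T1.
apply: (extreme_of_endpoint p1 q1 x1 y1 hT) => s' hs'.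
have := leading_eq_le (curve_leading p1 x1) (curve_leading q1 y1) eo
  (fun t => contraction_curve t (lt_trans ltr01 p1) x1 hs').
rewrite -ec (ler_pM2l (curve_coef_gt0 q1 y1)) => h.
rewrite leNgt; apply/negP => /(gt0_ltr_powR (curve_order_gt0 x p1)).
by rewrite !nnegrE !normr_ge0 => /(_ isT isT); rewrite ltNge h.
Qed.

(* By rotation invariance of the Euclidean norm a degenerate [x] can be traded for
   a nondegenerate one. *)
Lemma contraction_euclid_dom q x x' y s : lpnorm 2 x = 1 -> lpnorm 2 x' = 1 ->
  contraction 2 q (opfam 2 q x y s) -> contraction 2 q (opfam 2 q x' y s).
Proof.
have p0 : 0 < 2 :> R by rewrite ltr0n.
move=> x1 x1' /(opfam_contractionP _ _ _ p0 x1) h.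
by apply/(opfam_contractionP _ _ _ p0 x1') => a b; rewrite lpnorm2_line // -(lpnorm2_line _ _ x1); apply: h.
Qed.

Lemma contraction_euclid_codom p x y y' s : 0 < p -> lpnorm p x = 1 ->
  lpnorm 2 y = 1 -> lpnorm 2 y' = 1 ->
  contraction p 2 (opfam p 2 x y s) -> contraction p 2 (opfam p 2 x y' s).
Proof.
move=> p0 x1 y1 y1' /(opfam_contractionP _ _ _ p0 x1) h.
apply/(opfam_contractionP _ _ _ p0 x1) => a b.
by rewrite (lpnorm2_line _ _ y1') -(lpnorm2_line _ _ y1); apply: h.
Qed.

Lemma critical_coefs p q x y s : 1 < p -> 1 < q ->
  lpnorm p x = 1 -> lpnorm q y = 1 -> nondeg x -> nondeg y ->
  contraction p q (opfam p q x y s) ->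
  curve_coef q y * `|s| `^ 2 = curve_coef p x ->
  exists l : R, [/\ l != 0,
    l = s * (x 0 0 * x 1 0) / (y 0 0 * y 1 0),
    l ^+ 2 * bcoef2 q (`|y 0 0| `^ q) = bcoef2 p (`|x 0 0| `^ p),
    l ^+ 3 * bcoef3 q (`|y 0 0| `^ q) = bcoef3 p (`|x 0 0| `^ p) &
    l ^+ 4 * bcoef4 q (`|y 0 0| `^ q) <= bcoef4 p (`|x 0 0| `^ p)].
Proof.
move=> p1 q1 x1 y1 nx ny hT crit.
have [hle e2] := critical_nondeg p1 q1 x1 y1 nx ny hT crit.
have pN0 : p != 0 by rewrite gt_eqF // (lt_trans ltr01 p1).
have qN0 : q != 0 by rewrite gt_eqF // (lt_trans ltr01 q1).
have [e3 e4] := bmean_compare pN0 qN0 hle e2.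
eexists; split; last exact: e4.
- have := bcoef2_gt0 p1 (nondeg_itv p1 x1 nx); rewrite -e2.
  by apply: contraTneq => ->; rewrite expr0n mul0r ltxx.
- by [].
- exact: e2.
- exact: e3.
Qed.

Lemma critical_nondeg_absurd p q x y s : 1 < q <= 2 -> 2 <= p -> q < p ->
  lpnorm p x = 1 -> lpnorm q y = 1 -> nondeg x -> nondeg y ->
  contraction p q (opfam p q x y s) ->
  curve_coef q y * `|s| `^ 2 = curve_coef p x -> False.
Proof.
move=> q12 p2 qp x1 y1 nx ny hT crit; have /andP[q1 q2] := q12.
have p1 : 1 < p by apply: lt_trans qp.
have [l [_ _ e2 e3 e4]] := critical_coefs p1 q1 x1 y1 nx ny hT crit.
exact: (critical_absurd q12 p2 qp (nondeg_itv p1 x1 nx) (nondeg_itv q1 y1 ny) e2 e3 e4).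
Qed.

(** The Taylor conditions force the two means to coincide, so the norm is attained along the whole
    tangent line. *)
Lemma critical_nondeg_isometry p x y s t : 1 < p -> p != 2 ->
  lpnorm p x = 1 -> lpnorm p y = 1 -> nondeg x -> nondeg y ->
  contraction p p (opfam p p x y s) ->
  curve_coef p y * `|s| `^ 2 = curve_coef p x ->
  curve p y (s * t) = curve p x t.
Proof.
move=> p1 p2 x1 y1 nx ny hT crit.
have [l [_ lE e2 e3 _]] := critical_coefs p1 p1 x1 y1 nx ny hT crit.
rewrite (curve_nondeg _ p1 x1 nx) (curve_nondeg _ p1 y1 ny).
rewrite -(critical_same p1 p2 (nondeg_itv p1 x1 nx) e2 e3); congr (bmean _ _ _ `^ _).
rewrite lE; move: nx ny; rewrite /nondeg; move: (x 0 0 * _) (y 0 0 * _) => X Y X0 Y0.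
by field; rewrite X0 Y0.
Qed.

End Endpoints.

(** * Both exponents, or exactly one of them, equal to 2 *)

Section Classification.
Variable R : realType.
Implicit Types (k p q s t : R) (x y z : 'cV[R]_2) (T : 'M[R]_2).

#[local] Opaque lpnorm.

Lemma opnorm1_opfam p q T : 1 < p -> 1 < q -> opnorm p q T = 1 ->
  exists x y s, [/\ lpnorm p x = 1, lpnorm q y = 1 & T = opfam p q x y s].
Proof.
move=> p1 q1 T1; have [hT [x x1 y1]] := opnorm_eq1 p1 q1 T1.
have [s eT] := contraction_opfam p1 q1 x1 y1 hT (erefl _).
by exists x, (T *m x), s.
Qed.

Lemma extreme_cases p q T : 1 < p -> 1 < q -> opnorm p q T = 1 ->
  extreme_contraction p q T ->
  attains_norm_on_two_independent p q T \/
  exists x y s, [/\ lpnorm p x = 1, lpnorm q y = 1, T = opfam p q x y s,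
    contraction p q (opfam p q x y s) &
    (forall t, t != 0 -> curve q y (s * t) < curve p x t) /\
    ((curve_order q y < curve_order p x /\ s = 0) \/
     (curve_order q y = curve_order p x /\
      curve_coef q y * `|s| `^ curve_order p x = curve_coef p x))].
Proof.
move=> p1 q1 T1 ext.
have [two|not2] := pselect (attains_norm_on_two_independent p q T); first by left.
right; have [x [y [s [x1 y1 eT]]]] := opnorm1_opfam p1 q1 T1.
exists x, y, s; move: T1 ext not2; rewrite eT => T1 ext not2.
have [hT _] := opnorm_eq1 p1 q1 T1.
split; [exact: x1|exact: y1|by []|exact: hT|split].
  move=> t t0; have := strict_of_not_two p1 q1 x1 y1 T1 not2 1 t0.
  by rewrite !scale1r.
exact: extreme_dichotomy p1 q1 x1 y1 T1 not2 ext.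
Qed.

(** In orthonormal bases [opfam 2 2 x y s] is diagonal with entries 1 and [s]: a contraction
    whenever [s^2 <= 1], and an isometry when [s^2 = 1]. If [|s| < 1] there is room [1 - |s|] on
    both sides. Conversely an isometry attains its norm at both coordinate vectors. *)
Lemma extreme_euclid_isometry T : opnorm 2 2 T = 1 ->
  extreme_contraction 2 2 T <-> isometry_op 2 2 T.
Proof.
have p1 : 1 < 2 :> R by rewrite ltr1n.
have p0 : 0 < 2 :> R by rewrite ltr0n.
move=> T1; split=> [ext|iso]; last first.
  apply: extreme_of_two => //; exists (evec 0), (evec 1); split.
  - apply/free_pairP; rewrite /dot !perpE !evecE !mxE /= mulr1 mulr0 add0r.
    exact: oner_neq0.
  - by split; [rewrite -(lpnorm_gt0 _ p0) lpnorm_evec ?ltr01|rewrite T1 mul1r; exact: iso].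
  - by split; [rewrite -(lpnorm_gt0 _ p0) lpnorm_evec ?ltr01|rewrite T1 mul1r; exact: iso].
have [x [y [s [x1 y1 eT]]]] := opnorm1_opfam p1 p1 T1.
have contrP r : r ^+ 2 <= 1 -> contraction 2 2 (opfam 2 2 x y r).
  move=> r1; apply/(opfam_contractionP _ _ _ p0 x1) => a b.
  rewrite (lpnorm2_line a (r * b) y1) (lpnorm2_line a b x1).
  apply: ge0_ler_powR; rewrite ?nnegrE ?addr_ge0 ?sqr_ge0 ?invr_ge0 ?(ltW p0) //.
  by rewrite lerD2l exprMn ler_piMl ?sqr_ge0.
have s1 : s ^+ 2 = 1.
  have [hT _] := opnorm_eq1 p1 p1 T1; rewrite eT in hT ext.
  have := leading_eq_le (curve_leading p1 x1) (curve_leading p1 y1)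
    (etrans (curve_order2 y) (esym (curve_order2 x)))
    (fun t => contraction_curve t p0 x1 hT).
  rewrite curve_order2 (curve_coef2 x1) (curve_coef2 y1) ger_pMr ?invr_gt0 // => h.
  have {}h : s ^+ 2 <= 1.
    by move: h; rewrite -[X in _ `^ X]/(2%:R) powR_mulrn // real_normK ?num_real.
  have {h} sle : `|s| <= 1 by rewrite -(@ler_pXn2r _ 2) ?nnegrE // expr1n real_normK ?num_real.
  apply/eqP; rewrite -[s ^+ 2]real_normK ?num_real // sqrp_eq1 ?normr_ge0 //.
  rewrite eq_le sle /= leNgt; apply/negP => slt.
  have e0 : 0 < 1 - `|s| by rewrite subr_gt0.
  have sq (r : R) : `|r| <= 1 -> r ^+ 2 <= 1.
    by move=> r1; rewrite -[leLHS]real_normK ?num_real // expr_le1.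
  apply: (extreme_no_room p1 p1 x1 y1 e0 ext); apply/contrP/sq.
    by rewrite (le_trans (ler_normD _ _)) // (gtr0_norm e0) addrC subrK.
  by rewrite (le_trans (ler_normB _ _)) // (gtr0_norm e0) addrC subrK.
move=> z; rewrite eT (tangent_decomposition z p0 x1).
move: (dot (spow _ _) _) (dot (perp _) _) => a b.
by rewrite (opfam_line _ _ _ _ _ p0 x1) (lpnorm2_line a (s * b) y1) (lpnorm2_line a b x1) exprMn s1 mul1r.
Qed.

Lemma eq_or_opp_of_sqr (a b : R) : a ^+ 2 = b ^+ 2 -> a = b \/ a = - b.
Proof. by move=> /eqP; rewrite eqf_sqr => /orP[] /eqP ->; [left|right]. Qed.

Lemma unit_half_half p x : 0 < p -> lpnorm p x = 1 -> 2 * `|x 0 0| `^ p - 1 = 0 ->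
  `|x 0 0| `^ p = 1 / 2 /\ `|x 1 0| `^ p = 1 / 2.
Proof.
move=> p0 x1; have {x1} := (lpnorm_eq1 x p0).1 x1; rewrite /psum.
by move: (_ `^ p) (_ `^ p) => a b ab e; split; lra.
Qed.

Lemma powR2_norm s : `|s| `^ 2 = s ^+ 2.
Proof. by rewrite -[X in _ `^ X]/(2%:R) powR_mulrn // real_normK ?num_real. Qed.

Lemma extreme_from_euclid q T : 1 < q -> opnorm 2 q T = 1 -> q <> 2 ->
    (extreme_contraction 2 q T <->
      attains_norm_on_two_independent 2 q T \/
      (q < 2 /\ exists (x : 'cV[R]_2) (i : 'I_2),
         lpnorm 2 x = 1 /\ T = rank_one x (evec i)) \/
      (2 < q /\ exists (x y : 'cV[R]_2) (s : R),
         [/\ lpnorm 2 x = 1,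
             `|y 0 0| `^ q = 1 / 2 /\ `|y 1 0| `^ q = 1 / 2,
             s = 1 / Num.sqrt (q - 1) * 2 `^ ((q - 2) / q) \/
             s = - (1 / Num.sqrt (q - 1) * 2 `^ ((q - 2) / q)) &
             T = rank_one x y + s *: rank_one (perp x) (spow (q - 1) (perp y))])).
Proof.
move=> q1 T1 /eqP qN2.
have p1 : 1 < 2 :> R by rewrite ltr1n.
have p0 : 0 < 2 :> R by rewrite ltr0n.
have q0 : 0 < q := lt_trans ltr01 q1.
have q10 : 0 < q - 1 by rewrite subr_gt0.
have opE x y s : rank_one x y + s *: rank_one (perp x) (spow (q - 1) (perp y))
    = opfam 2 q x y s by rewrite /opfam spow1 spow_perp.
have S2 : (1 / Num.sqrt (q - 1) * 2 `^ ((q - 2) / q)) ^+ 2 =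
    (2 `^ ((q - 2) / q)) ^+ 2 / (q - 1).
  by rewrite exprMn div1r exprVn sqr_sqrtr ?(ltW q10) // mulrC.
have K0 : (2 `^ ((q - 2) / q) : R) != 0 by rewrite gt_eqF // powR_gt0.
have q1N0 : q - 1 != 0 by rewrite gt_eqF.
split=> [ext|].
  have [two|[x [y [s [x1 y1 eT hT [_ dich]]]]]] := extreme_cases p1 q1 T1 ext.
    by left.
  right; move: dich; rewrite curve_order2 (curve_coef2 x1).
  have [ny|dy] := boolP (nondeg y); last first.
    rewrite /curve_order (negbTE dy) => -[[q2 s0]|[e _]]; last by rewrite e eqxx in qN2.
    have [i [k [k1 yE]]] := deg_unitP q0 y1 dy.
    (* The sign [k] of [y] is absorbed into [x]. *)
    left; split=> //; exists (k *: x), i; rewrite lpnorm_unitZ //; split=> //.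
    by rewrite eT s0 opfam0 spow1 yE rank_oneZ.
  rewrite {1 2}/curve_order ny ltxx => -[[]//|[_ crit]].
  have [x' [x'1 nx']] := @diagonal_unit R _ p0.
  have hT' := contraction_euclid_dom x1 x'1 hT.
  (* All Euclidean unit vectors share the coefficient [1/2], so the critical equation passes to
     [x']. *)
  rewrite -(curve_coef2 x'1) in crit.
  have [q2|q2|e] := ltgtP q 2; last by rewrite e eqxx in qN2.
    (* Here [q < 2 = p], which the third- and fourth-order conditions exclude. *)
    by case: (@critical_nondeg_absurd _ 2 q x' y s) => //; rewrite q1 ltW.
  right; split=> //; exists x, y, s.
  have [l [l0 _ e2 e3 _]] := critical_coefs p1 q1 x'1 y1 nx' ny hT' crit.
  (* For [p = 2] the right side vanishes; as [q] is not 2 and [l] is not 0, this forces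
     [|y_1|^q = 1/2]. *)
  have := critical_third p1 (nondeg_itv p1 x'1 nx') e2 e3.
  rewrite subrr mul0r => /eqP; rewrite !mulf_eq0 (negbTE l0) orbF.
  rewrite subr_eq0 (negbTE qN2) /= => /eqP hb.
  have [y00 y10] := unit_half_half q0 y1 hb.
  have [_ _ cy] := half_coef q1 y00 y10.
  split=> //; last by rewrite opE.
  apply: eq_or_opp_of_sqr; rewrite S2.
  move: crit; rewrite cy (curve_coef2 x'1) powR2_norm => crit.
  have : (q - 1) / 2 / 2 `^ ((q - 2) / q) ^+ 2 * s ^+ 2 *
     (2 * 2 `^ ((q - 2) / q) ^+ 2 / (q - 1)) = s ^+ 2.
    by field; rewrite ?K0 ?q1N0.
  by rewrite crit => <-; field; rewrite ?K0 ?q1N0.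
move=> [two|[[q2 [x [i [x1 eT]]]]|[q2 [x [y [s [x1 [y0 y1] hs eT]]]]]]].
- exact: extreme_of_two.
- have e : T = opfam 2 q x (evec i) 0 by rewrite opfam0 spow1.
  rewrite e in T1 *; apply: (extreme_rank_one p1 q1 x1 (lpnorm_evec i q0) _ T1).
  by rewrite curve_order2 /curve_order nondeg_evec.
have [y1' ny cy] := half_coef q1 y0 y1.
rewrite opE in eT; rewrite eT in T1 *; apply: (extreme_critical p1 q1 x1 y1' _ _ T1).
  by rewrite curve_order2 /curve_order ny.
rewrite curve_order2 (curve_coef2 x1) cy powR2_norm.
have -> : s ^+ 2 = (2 `^ ((q - 2) / q)) ^+ 2 / (q - 1).
  by rewrite -S2; case: hs => ->; rewrite ?sqrrN.
by field; rewrite q1N0 K0.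
Qed.

Lemma extreme_to_euclid p T : 1 < p -> opnorm p 2 T = 1 -> p <> 2 ->
    (extreme_contraction p 2 T <->
      attains_norm_on_two_independent p 2 T \/
      (2 < p /\ exists (i : 'I_2) (y : 'cV[R]_2),
         lpnorm 2 y = 1 /\ T = rank_one (evec i) y) \/
      (p < 2 /\ exists (x y : 'cV[R]_2) (s : R),
         [/\ lpnorm 2 y = 1,
             `|x 0 0| `^ p = 1 / 2 /\ `|x 1 0| `^ p = 1 / 2,
             s = Num.sqrt (p - 1) * 2 `^ ((2 - p) / p) \/
             s = - (Num.sqrt (p - 1) * 2 `^ ((2 - p) / p)) &
             T = rank_one (spow (p - 1) x) y + s *: rank_one (perp x) (perp y)])).
Proof.
move=> p1 T1 /eqP pN2.
have q1 : 1 < 2 :> R by rewrite ltr1n.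
have q0 : 0 < 2 :> R by rewrite ltr0n.
have p0 : 0 < p := lt_trans ltr01 p1.
have p10 : 0 < p - 1 by rewrite subr_gt0.
have opE x y s : rank_one (spow (p - 1) x) y + s *: rank_one (perp x) (perp y)
    = opfam p 2 x y s by rewrite /opfam /tangent spow1.
have S2 : (Num.sqrt (p - 1) * 2 `^ ((2 - p) / p)) ^+ 2 =
    (p - 1) / (2 `^ ((p - 2) / p)) ^+ 2.
  have -> : (2 - p) / p = - ((p - 2) / p) by rewrite -mulNr opprB.
  by rewrite powRN exprMn exprVn sqr_sqrtr ?(ltW p10).
have K0 : (2 `^ ((p - 2) / p) : R) != 0 by rewrite gt_eqF // powR_gt0.
have p1N0 : p - 1 != 0 by rewrite gt_eqF.
split=> [ext|].
  have [two|[x [y [s [x1 y1 eT hT [_ dich]]]]]] := extreme_cases p1 q1 T1 ext.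
    by left.
  right; move: dich; rewrite curve_order2 (curve_coef2 y1).
  have [nx|dx] := boolP (nondeg x); last first.
    rewrite /curve_order (negbTE dx) => -[[p2 s0]|[e _]]; last by rewrite e eqxx in pN2.
    have [i [k [k1 xE]]] := deg_unitP p0 x1 dx.
    left; split=> //; exists i, (k *: y); rewrite lpnorm_unitZ //; split=> //.
    by rewrite eT s0 opfam0 xE spow_unitZ // spow_evec rank_oneZ.
  rewrite /curve_order nx ltxx => -[[]//|[_ crit]].
  have [y' [y'1 ny']] := @diagonal_unit R _ q0.
  have hT' := contraction_euclid_codom p0 x1 y1 y'1 hT.
  rewrite -(curve_coef2 y'1) in crit.
  have [p2|p2|e] := ltgtP p 2; last by rewrite e eqxx in pN2.
    right; split=> //; exists x, y, s.
    have [l [l0 _ e2 e3 _]] := critical_coefs p1 q1 x1 y'1 nx ny' hT' crit.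
    (* Now the left side vanishes because the exponent of the codomain is 2, and [|x_1|^p = 1/2]
       follows. *)
    have := critical_third p1 (nondeg_itv p1 x1 nx) e2 e3.
    rewrite subrr !mul0r => /esym/eqP; rewrite mulf_eq0.
    rewrite subr_eq0 (negbTE pN2) /= => /eqP hb.
    have [x00 x10] := unit_half_half p0 x1 hb.
    have [_ _ cx] := half_coef p1 x00 x10.
    split=> //; last by rewrite opE.
    apply: eq_or_opp_of_sqr; rewrite S2.
    move: crit; rewrite cx (curve_coef2 y'1) powR2_norm => crit.
    have : 2^-1 * s ^+ 2 * 2 = s ^+ 2 by field.
    by rewrite crit => <-; field; rewrite ?K0.
  (* Here the exponent of the codomain is [2 < p], which the higher-order conditions exclude. *)
  by case: (@critical_nondeg_absurd _ p 2 x y' s) => //; rewrite ?q1 ?lexx // ltW.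
move=> [two|[[p2 [i [y [y1 eT]]]]|[p2 [x [y [s [y1 [x0 x1] hs eT]]]]]]].
- exact: extreme_of_two.
- have e : T = opfam p 2 (evec i) y 0 by rewrite opfam0 spow_evec.
  rewrite e in T1 *; apply: (extreme_rank_one p1 q1 (lpnorm_evec i p0) y1 _ T1).
  by rewrite curve_order2 /curve_order nondeg_evec.
have [x1' nx cx] := half_coef p1 x0 x1.
rewrite opE in eT; rewrite eT in T1 *; apply: (extreme_critical p1 q1 x1' y1 _ _ T1).
  by rewrite curve_order2 /curve_order nx.
rewrite /curve_order nx (curve_coef2 y1) cx powR2_norm.
have -> : s ^+ 2 = (p - 1) / (2 `^ ((p - 2) / p)) ^+ 2.
  by rewrite -S2; case: hs => ->; rewrite ?sqrrN.
by field; rewrite K0.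
Qed.

End Classification.

(** * Equal exponents different from 2, and exponents separated by 2 *)

Section OtherExponents.
Variable R : realType.
Implicit Types (k p q s t : R) (x y z : 'cV[R]_2) (T : 'M[R]_2).

#[local] Opaque lpnorm.

(** Each order is 2 or [p]. If exactly one of [x], [y] is degenerate the orders differ, and only the
    rank-one operator can be extreme; if both or neither are, criticality makes the curves coincide
    at [t = 1], against strictness. *)
Lemma extreme_same_exponent p T : 1 < p -> opnorm p p T = 1 -> p <> 2 ->
    (extreme_contraction p p T <->
      attains_norm_on_two_independent p p T \/
      (2 < p /\ exists (i : 'I_2) (y : 'cV[R]_2),
         [/\ lpnorm p y = 1, y 0 0 * y 1 0 <> 0 & T = rank_one (evec i) y]) \/
      (p < 2 /\ exists (x : 'cV[R]_2) (j : 'I_2),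
         [/\ lpnorm p x = 1, x 0 0 * x 1 0 <> 0 &
             T = rank_one (spow (p - 1) x) (evec j)])).
Proof.
move=> p1 T1 /eqP p2; have p0 : 0 < p := lt_trans ltr01 p1.
have nondegZ k x : `|k| = 1 -> nondeg x -> (k *: x) 0 0 * (k *: x) 1 0 <> 0.
  move=> k1 nx; apply/eqP; rewrite !mxE mulrACA mulf_neq0 // -normr_gt0 normrM k1 mulr1.
  exact: ltr01.
split=> [ext|].
  have [two|[x [y [s [x1 y1 eT hT [strict dich]]]]]] := extreme_cases p1 p1 T1 ext.
    by left.
  have st := strict 1 (oner_neq0 _).
  right; move: dich; rewrite /curve_order.
  have [nx|dx] := boolP (nondeg x); have [ny|dy] := boolP (nondeg y).
  - rewrite ltxx => -[[]//|[_ crit]].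
    have e := critical_nondeg_isometry 1 p1 p2 x1 y1 nx ny hT crit.
    by rewrite e ltxx in st.
  - move=> [[plt s0]|[e _]]; last by rewrite e eqxx in p2.
    right; split; first exact: plt.
    have [j [k [k1 yE]]] := deg_unitP p0 y1 dy.
    exists (k *: x), j; split; first by rewrite lpnorm_unitZ.
      exact: nondegZ.
    by rewrite eT s0 opfam0 yE spow_unitZ // rank_oneZ.
  - move=> [[plt s0]|[e _]]; last by rewrite -e eqxx in p2.
    left; split; first exact: plt.
    have [i [k [k1 xE]]] := deg_unitP p0 x1 dx.
    exists i, (k *: y); split; first by rewrite lpnorm_unitZ.
      exact: nondegZ.
    by rewrite eT s0 opfam0 xE spow_unitZ // spow_evec rank_oneZ.
  (* Both vectors are degenerate, so the coefficients are both [p^-1] and criticality means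
     [|s| = 1]. *)
  - rewrite ltxx => -[[]//|[_ crit]].
    have pV0 : p^-1 != 0 by rewrite invr_eq0 gt_eqF.
    have {}crit : `|s| `^ p = 1.
      by apply: (mulfI pV0); rewrite mulr1; move: crit; rewrite /curve_coef (negbTE dx) (negbTE dy).
    by move: st; rewrite !curve_deg // mulr1 crit normr1 powR1 ltxx.
move=> [two|[[plt [i [y [y1 ny eT]]]]|[plt [x [j [x1 nx eT]]]]]].
- exact: extreme_of_two.
- have e : T = opfam p p (evec i) y 0 by rewrite opfam0 spow_evec.
  rewrite e in T1 *; apply: (extreme_rank_one p1 p1 (lpnorm_evec i p0) y1 _ T1).
  rewrite /curve_order nondeg_evec ifT //; exact/eqP.
rewrite -(opfam0 p p) in eT; rewrite eT in T1 *.
apply: (extreme_rank_one p1 p1 x1 (lpnorm_evec j p0) _ T1).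
rewrite /curve_order nondeg_evec ifT //; exact/eqP.
Qed.

(** The order at [y] is [q] or 2 and that at [x] is 2 or [p], so the first is smaller unless both
    vectors are nondegenerate. In that last case criticality is impossible. *)
Lemma extreme_decreasing_exponent p q T : 1 < q -> q < 2 -> 2 < p ->
    opnorm p q T = 1 ->
    (extreme_contraction p q T <->
      attains_norm_on_two_independent p q T \/
      exists x y : 'cV[R]_2,
        [/\ lpnorm p x = 1, lpnorm q y = 1,
            x 0 0 * x 1 0 * y 0 0 * y 1 0 = 0 &
            T = rank_one (spow (p - 1) x) y]).
Proof.
move=> q1 q2 p2 T1; have qp : q < p := lt_trans q2 p2.
have p1 : 1 < p := lt_trans q1 qp.
have order_lt x y : ~~ (nondeg x && nondeg y) -> curve_order q y < curve_order p x.
  by rewrite /curve_order; case: (nondeg x); case: (nondeg y).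
split=> [ext|].
  have [two|[x [y [s [x1 y1 eT hT [_ dich]]]]]] := extreme_cases p1 q1 T1 ext.
    by left.
  right; have [/andP[nx ny]|dxy] := boolP (nondeg x && nondeg y).
    move: dich; rewrite /curve_order nx ny ltxx => -[[]//|[_ crit]].
    have q12 : 1 < q <= 2 by rewrite q1 ltW.
    by case: (critical_nondeg_absurd q12 (ltW p2) qp x1 y1 nx ny hT crit).
  exists x, y; split; [exact: x1|exact: y1| |].
    apply/eqP; rewrite -mulrA mulf_eq0.
    by move: dxy; rewrite negb_and /nondeg !negbK.
  case: dich => [[_ s0]|[e _]]; first by rewrite eT s0 opfam0.
  by have := order_lt _ _ dxy; rewrite e ltxx.
move=> [two|[x [y [x1 y1 xy eT]]]]; first exact: extreme_of_two.
rewrite -(opfam0 _ q) in eT; rewrite eT in T1 *.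
apply: (extreme_rank_one p1 q1 x1 y1 _ T1); apply: order_lt.
by rewrite negb_and /nondeg !negbK -mulf_eq0 mulrA xy.
Qed.

End OtherExponents.

Theorem theorem2p2 (R : realType) (p q : R) (hp : 1 < p) (hq : 1 < q)
    (T : 'M[R]_2) (hT : opnorm p q T = 1) :
  (* (i) *)
  (p = 2 -> q = 2 ->
    (extreme_contraction p q T <-> isometry_op p q T)) /\
  (* (ii) *)
  (p = 2 -> q <> 2 ->
    (extreme_contraction p q T <->
      attains_norm_on_two_independent p q T \/
      (q < 2 /\ exists (x : 'cV[R]_2) (i : 'I_2),
         lpnorm 2 x = 1 /\ T = rank_one x (evec i)) \/
      (2 < q /\ exists (x y : 'cV[R]_2) (s : R),
         [/\ lpnorm 2 x = 1,
             `|y 0 0| `^ q = 1 / 2 /\ `|y 1 0| `^ q = 1 / 2,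
             s = 1 / Num.sqrt (q - 1) * 2 `^ ((q - 2) / q) \/
             s = - (1 / Num.sqrt (q - 1) * 2 `^ ((q - 2) / q)) &
             T = rank_one x y + s *: rank_one (perp x) (spow (q - 1) (perp y))]))) /\
  (* (iii) *)
  (p <> 2 -> q = 2 ->
    (extreme_contraction p q T <->
      attains_norm_on_two_independent p q T \/
      (2 < p /\ exists (i : 'I_2) (y : 'cV[R]_2),
         lpnorm 2 y = 1 /\ T = rank_one (evec i) y) \/
      (p < 2 /\ exists (x y : 'cV[R]_2) (s : R),
         [/\ lpnorm 2 y = 1,
             `|x 0 0| `^ p = 1 / 2 /\ `|x 1 0| `^ p = 1 / 2,
             s = Num.sqrt (p - 1) * 2 `^ ((2 - p) / p) \/
             s = - (Num.sqrt (p - 1) * 2 `^ ((2 - p) / p)) &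
             T = rank_one (spow (p - 1) x) y + s *: rank_one (perp x) (perp y)]))) /\
  (* (iv) *)
  (p = q -> p <> 2 ->
    (extreme_contraction p q T <->
      attains_norm_on_two_independent p q T \/
      (2 < p /\ exists (i : 'I_2) (y : 'cV[R]_2),
         [/\ lpnorm p y = 1, y 0 0 * y 1 0 <> 0 & T = rank_one (evec i) y]) \/
      (p < 2 /\ exists (x : 'cV[R]_2) (j : 'I_2),
         [/\ lpnorm p x = 1, x 0 0 * x 1 0 <> 0 &
             T = rank_one (spow (p - 1) x) (evec j)]))) /\
  (* (v) *)
  (q < 2 -> 2 < p ->
    (extreme_contraction p q T <->
      attains_norm_on_two_independent p q T \/
      exists x y : 'cV[R]_2,
        [/\ lpnorm p x = 1, lpnorm q y = 1,
            x 0 0 * x 1 0 * y 0 0 * y 1 0 = 0 &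
            T = rank_one (spow (p - 1) x) y])).
Proof.
split; [|split; [|split; [|split]]].
- by move=> ep eq; move: hT; rewrite ep eq; apply: extreme_euclid_isometry.
- by move=> ep q2; move: hT; rewrite ep => T1; apply: extreme_from_euclid.
- by move=> p2 eq; move: hT; rewrite eq => T1; apply: extreme_to_euclid.
- by move=> epq p2; move: hT; rewrite -epq => T1; apply: extreme_same_exponent.
- by move=> q2 p2; apply: extreme_decreasing_exponent.
Qed.
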